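(* Let $\mu$ be a finite complex Borel measure on the circle $[0,2\pi]$ (with $0$ and $2\pi$ identified) such that $\widehat{\mu}(l)\to 0$ as $|l|\to\infty$, and let $(n_k)_{k\ge1}$ be a sequence of positive integers with $n_k\to\infty$ such that $$\lim_{k\to\infty}\sum_{l=-n_k}^{n_k}\widehat{\mu}(l)e^{ilx}=0\qquad\text{for every }x\in[0,2\pi].$$ Then $\mu=0$.
   Context: Fourier coefficients are $\widehat{\mu}(l)=\frac{1}{2\pi}\int e^{-ilx}\,d\mu(x)$, $l\in\mathbb{Z}$. *)

(* Defs.v *)
From HB Require Import structures.
From mathcomp Require Import all_boot all_order all_algebra.
From mathcomp Require Import generic_quotient.
From mathcomp Require Import all_classical all_reals all_analysis.
From mathcomp Require Import complex.

Set Implicit Arguments.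
Unset Strict Implicit.
Unset Printing Implicit Defensive.

Import Order.TTheory GRing.Theory Num.Theory.
Import numFieldNormedType.Exports.

Local Open Scope classical_set_scope.
Local Open Scope ring_scope.
Local Open Scope quotient_scope.

Definition eqmod2pi (R : realType) : rel R :=
  fun x y => `[< exists k : int, x - y = (2 * pi) * k%:~R >].

Lemma eqmod2pi_is_equiv (R : realType) : equiv_class_of (@eqmod2pi R).
Proof.
split.
- by move=> x; apply/asboolP; exists 0; rewrite subrr mulr0.
- move=> x y; apply/asboolP/asboolP => -[k hk]; exists (- k);
    by rewrite -opprB hk mulrNz mulrN.
- move=> y x z /asboolP[k hk] /asboolP[l hl]; apply/asboolP; exists (k + l).
  by rewrite mulrzDr mulrDr -hk -hl addrA subrK.
Qed.

Canonical eqmod2pi_equiv (R : realType) := EquivRelPack (@eqmod2pi_is_equiv R).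

(* R / 2 pi Z, i.e. [0, 2 pi] with its endpoints identified, with the quotient
   topology; [circleB] is the same set with its Borel sigma-algebra. *)
Definition circle (R : realType) := quotient_topology {eq_quot (@eqmod2pi_equiv R)}.
HB.instance Definition _ (R : realType) := Topological.on (circle R).
HB.instance Definition _ (R : realType) := Pointed.on (circle R).
HB.instance Definition _ (R : realType) := Quotient.on (circle R).

Definition circleB (R : realType) := g_sigma_algebraType (open : set (set (circle R))).
HB.instance Definition _ (R : realType) := Measurable.on (circleB R).


(* Charges are finite on measurable sets, so a charge with values in \bar R[i] is
   a finite complex measure. Its real and imaginary parts are the signed
   measures below. *)
Section parts_of_complex_charge.
Context d (T : measurableType d) (R : realType).
Variable mu : {charge set T -> \bar R[i]}.

Let semi_sigma_additive_part (f : R[i] -> R) :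
    {morph f : x y / x - y} -> (forall z, (`|f z|%:C)%C <= `|z|) ->
  semi_sigma_additive (fun A => (f (fine (mu A)))%:E).
Proof.
move=> fB fle F mF tF mUF.
have f0 : f 0 = 0 by rewrite -(subrr 0) fB subrr.
have fD : {morph f : x y / x + y}.
  by move=> x y; rewrite -[y in LHS]opprK -(sub0r y) !fB f0 sub0r opprK.
have fmu A : measurable A -> mu A = (fine (mu A))%:E.
  by move=> mA; rewrite fineK//; exact: fin_num_measure.
have muF n : (\sum_(0 <= i < n) mu (F i))%E = (\sum_(0 <= i < n) fine (mu (F i)))%:E.
  by rewrite -sumEFin; apply: eq_bigr => i _; exact: fmu.
have fF n : (\sum_(0 <= i < n) (f (fine (mu (F i))))%:E)%E =
    (f (\sum_(0 <= i < n) fine (mu (F i))))%:E.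
  by rewrite (big_morph f fD f0) sumEFin.
have := @charge_semi_sigma_additive _ _ _ mu F mF tF mUF.
rewrite (fmu _ mUF) (eq_cvg _ _ muF) (eq_cvg _ _ fF) => cF.
apply/fine_cvgP; split; first exact: nearW.
apply/cvgrPdist_lt => e e0 /=.
have [] := cF [set x | exists2 z, x = z%:E &
                       `|fine (mu (\bigcup_n F n)) - z| < (e%:C)%C].
  exists (e%:C)%C => /=; first by rewrite ltcR.
  by apply/subsetP => z; rewrite !inE/= => zlt; exists z.
move=> N _ HN; exists N => // n /= Nn.
have [z [<-] zlt] := HN n Nn.
by rewrite -ltcR -fB; exact: le_lt_trans (fle _) zlt.
Qed.

Definition re_charge (A : set T) : \bar R := (complex.Re (fine (mu A)))%:E.

Let re_charge0 : re_charge set0 = 0%E.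
Proof. by rewrite /re_charge charge0. Qed.

Let re_charge_fin A : measurable A -> re_charge A \is a fin_num.
Proof. by []. Qed.

Let re_charge_sigma_additive : semi_sigma_additive re_charge.
Proof.
apply: semi_sigma_additive_part; last exact: normc_ge_Re.
by move=> [a b] [c e].
Qed.

HB.instance Definition _ := isCharge.Build _ _ _ re_charge
  re_charge0 re_charge_fin re_charge_sigma_additive.

Definition im_charge (A : set T) : \bar R := (complex.Im (fine (mu A)))%:E.

Let im_charge0 : im_charge set0 = 0%E.
Proof. by rewrite /im_charge charge0. Qed.

Let im_charge_fin A : measurable A -> im_charge A \is a fin_num.
Proof. by []. Qed.

Let im_charge_sigma_additive : semi_sigma_additive im_charge.
Proof.
apply: semi_sigma_additive_part; first by move=> [a b] [c e].
move=> [a b]; rewrite normc_def/= lecR -sqrtr_sqr.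
by rewrite ler_wsqrtr// lerDr sqr_ge0.
Qed.

HB.instance Definition _ := isCharge.Build _ _ _ im_charge
  im_charge0 im_charge_fin im_charge_sigma_additive.

End parts_of_complex_charge.

Section charge_integral.
Context d (T : measurableType d) (R : realType).

Lemma hahn_decompositionP (nu : {charge set T -> \bar R}) :
  exists PN : set T * set T, hahn_decomposition nu PN.1 PN.2.
Proof. by have [P [N PN]] := Hahn_decomposition nu; exists (P, N). Qed.

(* Integral against a signed measure via its Jordan decomposition. The value does
   not depend on the chosen Hahn decomposition (cf. Hahn_decomposition_uniq). *)
Definition charge_integral (nu : {charge set T -> \bar R}) (f : T -> R) : R :=
  let nuPN := projT2 (cid (hahn_decompositionP nu)) in
  \int[jordan_pos nuPN]_x f x - \int[jordan_neg nuPN]_x f x.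

Definition complex_charge_integral (mu : {charge set T -> \bar R[i]})
    (f : T -> R[i]) : R[i] :=
  let u x := complex.Re (f x) in let v x := complex.Im (f x) in
  ((charge_integral (re_charge mu) u - charge_integral (im_charge mu) v)
   +i* (charge_integral (re_charge mu) v + charge_integral (im_charge mu) u))%C.

End charge_integral.

Definition cis (R : realType) (t : R) : R[i] := (cos t +i* sin t)%C.

(* [repr x] is an arbitrary real representative of the class [x]; the integrand
   does not depend on it since [l] is an integer. *)
Definition fourier_coef (R : realType) (mu : {charge set (circleB R) -> \bar R[i]})
    (l : int) : R[i] :=
  ((2 * pi)^-1)%:C%C *
  complex_charge_integral mu (fun x : circle R => cis (- (l%:~R * repr x))).

Definition fourier_sum (R : realType) (mu : {charge set (circleB R) -> \bar R[i]})
    (n : nat) (x : R) : R[i] :=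
  \sum_(0 <= j < (2 * n).+1)
    let l := j%:Z - n%:Z in fourier_coef mu l * cis (l%:~R * x).

(* Main.v *)
(* Let F_n(x) be the n-th partial sum. The real and imaginary parts of mu satisfy
   the hypotheses separately, because the Dirichlet kernel is real; so let mu be
   real, with Jordan decomposition P - N.

   Call x charged if no neighbourhood of x is null for P + N. If mu <> 0 the set K
   of charged points is nonempty, and a Baire category argument on K gives an arc
   I, centred at a charged point, such that the F_{n_k} are uniformly bounded on
   the intersection of K and I; the complement of K is null. Let phi be a Lipschitz
   function supported in I with values in [0, 1], obtained as a bounded pointwise
   limit of trigonometric polynomials. Rajchman's localization principle says that
   F_n(phi mu) - phi F_n(mu) tends to 0 pointwise and boundedly, so phi F_{n_k}(phi mu)
   tends to 0 boundedly almost everywhere. By dominated convergence its integral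
   tends to 0; but that integral is a sum of squares of Fourier coefficients of
   phi mu and is at least (int phi dmu)^2. Hence int phi dmu = 0 for every such
   phi, and these phi determine mu on I: I is null, a contradiction. *)
Require Import Defs.
From mathcomp Require Import all_boot all_order all_algebra.
From mathcomp Require Import generic_quotient.
From mathcomp Require Import all_classical all_reals all_analysis.
From mathcomp Require Import complex.
From mathcomp Require Import measurable_realfun zify ring lra.

Set Implicit Arguments.
Unset Strict Implicit.
Unset Printing Implicit Defensive.

Import Order.TTheory GRing.Theory Num.Theory.
Import numFieldNormedType.Exports.

Local Open Scope classical_set_scope.
Local Open Scope ring_scope.

(** * Bounded measurable functions *)

Lemma eq_cvgn (R : realType) (u v : nat -> R) (l : R) :
  (forall n, v n = u n) -> u n @[n --> \oo] --> l -> v n @[n --> \oo] --> l.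
Proof. by move/funext => ->. Qed.

Lemma negligible_bigcup_countable d (T : measurableType d) (R : realType)
    (mu : {measure set T -> \bar R}) (I : countType) (F : I -> set T) :
  (forall i, mu.-negligible (F i)) -> mu.-negligible (\bigcup_i F i).
Proof.
move=> F0; pose G n := if @unpickle I n is Some i then F i else set0.
apply: (@negligibleS _ _ _ _ (\bigcup_n G n)).
  by move=> t [i _ Fit]; exists (pickle i) => //; rewrite /G pickleK.
apply: negligible_bigcup => n; rewrite /G; case: unpickle => [i|]; first exact: F0.
exact: negligible_set0.
Qed.

Section bounded_integrals.
Context d (T : measurableType d) (R : realType).
Variable m : {finite_measure set T -> \bar R}.
Implicit Types f g : T -> R.

Definition bounded_mfun f :=
  measurable_fun setT f /\ exists M, forall t, `|f t| <= M.

Lemma bounded_mfun_integrable f :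
  bounded_mfun f -> m.-integrable setT (EFin \o f).
Proof.
move=> [mf [M fM]]; apply: measurable_bounded_integrable => //.
  by rewrite ltey_eq fin_num_measure.
by exists M; split; [exact: num_real|move=> x Mx t _; exact: le_trans (fM t) (ltW Mx)].
Qed.

Lemma bounded_mfun_cst a : bounded_mfun (fun=> a).
Proof. by split; [exact: measurable_cst|exists `|a|]. Qed.

Lemma bounded_mfunD f g : bounded_mfun f -> bounded_mfun g ->
  bounded_mfun (fun t => f t + g t).
Proof.
move=> [mf [M fM]] [mg [M' gM']]; split; first exact: measurable_funD.
by exists (M + M') => t; rewrite (le_trans (ler_normD _ _))// lerD.
Qed.

Lemma bounded_mfunM f g : bounded_mfun f -> bounded_mfun g ->
  bounded_mfun (fun t => f t * g t).
Proof.
move=> [mf [M fM]] [mg [M' gM']]; split; first exact: measurable_funM.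
by exists (M * M') => t; rewrite normrM ler_pM.
Qed.

Lemma bounded_mfun_norm f : bounded_mfun f -> bounded_mfun (fun t => `|f t|).
Proof.
move=> [mf [M fM]]; split; first exact: measurableT_comp.
by exists M => t; rewrite normr_id.
Qed.

Lemma Rintegral_dominated_cvg0 (f_ : nat -> T -> R) (M : R) :
  (forall n, measurable_fun setT (f_ n)) ->
  {ae m, forall t n, `|f_ n t| <= M} ->
  {ae m, forall t, f_ n t @[n --> \oo] --> (0 : R)} ->
  (\int[m]_t `|f_ n t|) @[n --> \oo] --> (0 : R).
Proof.
move=> mf fM f0.
have [] := @dominated_convergence _ T R m setT measurableT
  (fun n => EFin \o f_ n) (cst 0%E) (cst M%:E).
- by move=> n; apply/measurable_EFinP.
- exact: measurable_cst.
- by apply: filterS f0 => t ft _; apply: cvg_EFin; [exact: nearW|exact: ft].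
- by apply: (@bounded_mfun_integrable (fun=> M)); exact: bounded_mfun_cst.
- by apply: filterS fM => t ft n _ /=; rewrite lee_fin.
rewrite (_ : [sequence _]_n = (fun n => \int[m]_t (`|f_ n t|)%:E)%E); last first.
  by apply/funext => n; apply: eq_integral => t _ /=; rewrite subr0.
by move=> _ /fine_cvg.
Qed.

End bounded_integrals.
(** * Real analysis *)

Section sign_iteration.
Variable R : realType.
Implicit Type t : R.

(* The iterates are odd polynomials that converge boundedly to the sign function
   on [-1, 1]. *)
Definition sgstep t : R := (3 * t - t ^+ 3) / 2.

Lemma sgstepN t : sgstep (- t) = - sgstep t.
Proof. by rewrite /sgstep; field. Qed.

Lemma iter_sgstepN n t : iter n sgstep (- t) = - iter n sgstep t.
Proof. by elim: n => //= n ->; rewrite sgstepN. Qed.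

(** [1 + sgstep s] and [1 - sgstep s] factor as a square times a factor that is positive on
    [-1, 1]. *)
Lemma norm_iter_sgstep n t : `|t| <= 1 -> `|iter n sgstep t| <= 1.
Proof.
move=> t1; elim: n => //= n; move: (iter n sgstep t) => s; rewrite !ler_norml.
rewrite /sgstep => /andP[s1 s2]; apply/andP; split.
  rewrite -subr_ge0 (_ : _ - _ = (1 + s) ^+ 2 * (2 - s) / 2); last by field.
  by rewrite divr_ge0// mulr_ge0 ?sqr_ge0//; lra.
rewrite -subr_ge0 (_ : _ - _ = (1 - s) ^+ 2 * (2 + s) / 2); last by field.
by rewrite divr_ge0// mulr_ge0 ?sqr_ge0//; lra.
Qed.

(** Since [1 - sgstep s = (1 - s) * (1 - (s + s ^+ 2) / 2)] and the iterates stay above [t], each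
    step shrinks the distance to 1 by a factor at most [1 - t / 2]. *)
Lemma iter_sgstep_pos n t : 0 < t <= 1 ->
  t <= iter n sgstep t /\ 1 - iter n sgstep t <= (1 - t / 2) ^+ n.
Proof.
move=> /andP[t0 t1]; elim: n => [|n]; first by rewrite /= expr0 lexx; split=> //; lra.
have : iter n sgstep t <= 1.
  by rewrite (le_trans (ler_norm _))// norm_iter_sgstep// ger0_norm// ltW.
rewrite iterS exprSr; move: (iter n sgstep t) => s s1 [ts IH].
have e : 1 - sgstep s = (1 - s) * (1 - (s + s ^+ 2) / 2) by rewrite /sgstep; field.
split.
  rewrite -subr_ge0 (_ : _ - _ = (s - t) + s * (1 - s) * (1 + s) / 2).
    by rewrite addr_ge0 ?subr_ge0// divr_ge0// !mulr_ge0//; lra.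
  by rewrite /sgstep; field.
rewrite e ler_pM//; first by rewrite subr_ge0.
  by rewrite subr_ge0; nra.
by have := sqr_ge0 s; lra.
Qed.

Lemma cvg_iter_sgstep t : `|t| <= 1 ->
  iter n sgstep t @[n --> \oo] --> Num.sg t.
Proof.
have pos s : 0 < s <= 1 -> iter n sgstep s @[n --> \oo] --> (1 : R).
  move=> s01; have [s0 s1] := andP s01.
  apply/subr_cvg0; apply/norm_cvg0P.
  have : `|1 - s / 2| < 1 by rewrite ltr_norml; lra.
  move=> /(cvg_geometric 1) g0; apply: (squeeze_cvgr _ (cvg_cst 0) g0).
  apply: nearW => n; rewrite normr_ge0/= distrC mul1r ger0_norm.
    by case: (iter_sgstep_pos n s01).
  by rewrite subr_ge0 (le_trans (ler_norm _))// norm_iter_sgstep// gtr0_norm.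
have [t0|t0|->] := ltgtP t 0; last first.
- move=> _; rewrite sgr0; apply: (@eq_cvgn _ (fun=> 0)); last exact: cvg_cst.
  by elim=> //= n ->; rewrite /sgstep; field.
- by move=> t1; rewrite gtr0_sg//; apply: pos; rewrite t0/= -(gtr0_norm t0).
- move=> t1; rewrite ltr0_sg//; have -> : t = - (- t) by rewrite opprK.
  apply: (eq_cvgn (fun n => iter_sgstepN n (- t))).
  by apply: cvgN; apply: pos; rewrite oppr_gt0 t0/= -(ltr0_norm t0).
Qed.

End sign_iteration.

(** * Closed forms of the Dirichlet kernel *)

Section dirichlet_kernel.
Variable R : realType.
Implicit Types (n : nat) (v : R).

Definition dirichlet n v : R := 1 + \sum_(l < n) 2 * cos (l.+1%:R * v).

Lemma dirichletS n v : dirichlet n.+1 v = dirichlet n v + 2 * cos (n.+1%:R * v).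
Proof. by rewrite /dirichlet big_ord_recr addrA. Qed.

(** The sum telescopes. The sine is kept as a factor rather than divided out, so that its zeros need
    no separate case. *)
Lemma dirichlet_sin n v :
  dirichlet n v * sin (v / 2) = sin (n%:R * v + v / 2).
Proof.
elim: n => [|n IH]; first by rewrite /dirichlet big_ord0 addr0 mul1r mul0r add0r.
rewrite dirichletS mulrDl IH.
have -> : n%:R * v + v / 2 = n.+1%:R * v - v / 2 by rewrite -natr1; field.
by rewrite sinB sinD; ring.
Qed.

(** A second factor of the sine brings back integer frequencies, to which decay of Fourier
    coefficients applies. *)
Lemma dirichlet_sin2 n v :
  dirichlet n v * sin (v / 2) ^+ 2 = (cos (n%:R * v) - cos (n.+1%:R * v)) / 2.
Proof.
rewrite expr2 mulrA dirichlet_sin.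
have -> : cos (n%:R * v) = cos (n%:R * v + v / 2 - v / 2) by congr cos; ring.
have -> : cos (n.+1%:R * v) = cos (n%:R * v + v / 2 + v / 2).
  by congr cos; rewrite -natr1; field.
by move: (v / 2) => b; move: (n%:R * v + b) => a; rewrite cosB cosD; field.
Qed.

Lemma sin2_half v : sin (v / 2) ^+ 2 = (1 - cos v) / 2.
Proof.
by rewrite [v in RHS](_ : v = (v / 2) *+ 2) ?cos_mulr2n ?sin2cos2 ?mulr2n; field.
Qed.

End dirichlet_kernel.

(** * Local boundedness by Baire category *)

(** Otherwise there are nested intervals centred in [K] such that on the i-th of them some [F k]
    exceeds i in absolute value; the sequence is then unbounded at a common point. Boundedness is
    used at that limit point, which is not shown to lie in [K]. *)
Lemma exists_locally_bounded_on (R : realType) (K : set R) (F : nat -> R -> R) :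
  (forall k, continuous (F k)) -> (forall x, exists M : R, forall k, `|F k x| <= M) ->
  K !=set0 -> exists x (r M : R),
    [/\ K x, 0 < r & forall k y, K y -> `|y - x| < r -> `|F k y| <= M].
Proof.
move=> cF bF [x0 Kx0]; apply: contrapT => nloc.
have unb x r M : K x -> 0 < r ->
    exists k y, [/\ K y, `|y - x| < r & M < `|F k y|].
  move=> Kx r0; apply: contrapT => h; apply: nloc; exists x, r, M; split=> // k y Ky yx.
  by rewrite leNgt; apply/negP => FM; apply: h; exists k, y.
(* A state is a step index, a centre and a radius; the index supplies the threshold to be exceeded
   at the next step. *)
pose S := {p : nat * R * R | K p.1.2 /\ 0 < p.2}.
pose step (p q : S) := let: (i, x, r) := sval p in let: (j, y, s) := sval q in
  [/\ j = i.+1, `|y - x| + s <= r &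
      exists k, forall z, `|z - y| <= s -> i%:R < `|F k z|].
have next p : {q | step p q}.
  apply: cid; case: p => -[[i x] r] [/= Kx r0].
  have [k [y [Ky yx Fy]]] := unb x r i%:R Kx r0.
  have /nbhs_ballP[s /= s0 sF] : \forall z \near y, i%:R < `|F k z|.
    exact: (cvgr_gt _ (cvg_norm (cF k y))).
  (* Halving [s] puts the closed interval inside the open ball where [F k] is large; the other term
     keeps it inside the previous interval. *)
  pose s' := Num.min (s / 2) (r - `|y - x|).
  have s'0 : 0 < s' by rewrite lt_min divr_gt0// subr_gt0.
  exists (exist _ (i.+1, y, s') (conj Ky s'0)); split=> //=.
    by rewrite -lerBrDl ge_min lexx orbT.
  exists k => z zy; apply: sF; rewrite /ball/= distrC (le_lt_trans zy)//.
  by rewrite (@le_lt_trans _ _ (s / 2)) ?ge_min ?lexx//; lra.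
have [p [p0 pstep]] := dependent_choice next (exist _ (0%N, x0, 1) (conj Kx0 ltr01)).
pose x j := (sval (p j)).1.2; pose r j := (sval (p j)).2.
have idx j : (sval (p j)).1.1 = j.
  elim: j => [|j IH]; first by rewrite p0.
  by move: (pstep j) IH; rewrite /step; case: (sval (p j)) (sval (p j.+1)) =>
    [[a b] c] [[a' b'] c'] [-> _ _] /= ->.
have r0 j : 0 < r j by rewrite /r; case: (p j) => ? [].
have nest j : `|x j.+1 - x j| + r j.+1 <= r j.
  by move: (pstep j); rewrite /step /x /r; case: (sval (p j)) (sval (p j.+1)) =>
    [[a b] c] [[a' b'] c'] [].
have big j : exists k, forall z, `|z - x j.+1| <= r j.+1 -> j%:R < `|F k z|.
  move: (pstep j) (idx j); rewrite /step /x /r; case: (sval (p j)) (sval (p j.+1)) =>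
    [[a b] c] [[a' b'] c'] [_ _ h] /= <-; exact: h.
pose a j := x j - r j; pose b j := x j + r j.
have nda : nondecreasing_seq a.
  by apply/nondecreasing_seqP => j; have := nest j; rewrite /a;
    have := ler_norm (x j - x j.+1); rewrite distrC; lra.
have nib : nonincreasing_seq b.
  by apply/nonincreasing_seqP => j; have := nest j; rewrite /b;
    have := ler_norm (x j.+1 - x j); lra.
have ab i j : a i <= b j.
  apply: (@le_trans _ _ (a (maxn i j))); first exact/nda/leq_maxl.
  apply: (@le_trans _ _ (b (maxn i j))); last exact/nib/leq_maxr.
  by rewrite /a /b; have := r0 (maxn i j); lra.
(* Every left end lies below every right end, so this supremum belongs to all the intervals. *)
pose s := sup (range a).
have sa j : a j <= s.
  by apply: ub_le_sup; [exists (b 0) => _ [i _ <-]; exact: ab|exists j].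
have sb j : s <= b j.
  by apply: ge_sup; [exists (a 0), 0%N|move=> _ [i _ <-]; exact: ab].
have [M FM] := bF s.
have [j Mj] : exists j : nat, M < j%:R.
  by exists (Num.bound `|M|); rewrite (le_lt_trans (ler_norm _))// archi_boundP.
have [k /(_ s)] := big j; rewrite ler_distl.
have := sa j.+1; have := sb j.+1; rewrite /a /b => -> -> /(_ isT).
by have := FM k; lra.
Qed.

(** * Distance modulo 2 pi *)

Lemma periodicz (R : realType) (f : R -> R) p :
  periodic f p -> forall (k : int) a, f (a + p *~ k) = f a.
Proof.
move=> fp [n|n] a; first exact: periodicn.
by rewrite NegzE mulrNz -[LHS](periodicn fp n.+1) subrK.
Qed.

Section chord.
Variable R : realType.
Implicit Types x y z r : R.

(* Half the Euclidean distance from e^(ix) to e^(iy). *)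
Definition chord x y : R := `|sin ((y - x) / 2)|.

Lemma chord_sqr x y : chord x y ^+ 2 = 2^-1 - 2^-1 * cos (y - x).
Proof. by rewrite real_normK ?num_real// sin2_half; field. Qed.

Lemma chord_le1 x y : chord x y <= 1.
Proof. exact: sin_max. Qed.

Lemma chordC x y : chord x y = chord y x.
Proof. by rewrite /chord -normrN -sinN -mulNr opprB. Qed.

Lemma chord_triangle z x y : chord x y <= chord x z + chord z y.
Proof.
rewrite /chord (_ : (y - x) / 2 = (z - x) / 2 + (y - z) / 2); last by field.
rewrite sinD (le_trans (ler_normD _ _))// !normrM.
by apply: lerD; rewrite ?ler_piMr ?ler_piMl ?cos_max.
Qed.

Lemma periodic_chord x : periodic (chord x) (pi *+ 2).
Proof.
move=> y; rewrite /chord (_ : _ / 2 = (y - x) / 2 + pi).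
  by rewrite sinDpi normrN.
by rewrite mulr2n; field.
Qed.

Lemma continuous_chord x : continuous (chord x).
Proof.
move=> y; apply: cvg_norm; apply: continuous_comp; last exact: continuous_sin.
by apply: cvgMr_tmp; apply: cvgB; [exact: cvg_id|exact: cvg_cst].
Qed.

(** A multiple of 2 pi brings [y - x] to some [w] in [-pi, pi]. There the chord is [sin (|w| / 2)],
    increasing in [|w|], so [s = sin (q / 2)] with [q = min r pi] works. *)
Lemma chord_lift r : 0 < r -> exists2 s, 0 < s <= 1 &
  forall x y, chord x y < s -> exists k : int, `|y + (pi *+ 2) *~ k - x| < r.
Proof.
move=> r0; have pi0 := pi_gt0 R.
pose q := Num.min r pi; have q0 : 0 < q by rewrite lt_min r0.
have qpi : q <= pi by rewrite ge_min lexx orbT.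
exists (sin (q / 2)).
  by rewrite sin_le1 andbT sin_gt0_pi//; lra.
move=> x y; have p0 : 0 < pi *+ 2 :> R by rewrite mulr2n addr_gt0.
pose k := - Num.floor ((y - x + pi) / (pi *+ 2)).
rewrite -(periodicz (periodic_chord x) k) => h; exists k; move: h.
have : - pi <= y + (pi *+ 2) *~ k - x <= pi.
  have := floor_itv ((y - x + pi) / (pi *+ 2)).
  rewrite /k mulrNz; move: (Num.floor _) => m.
  rewrite ler_pdivlMr// ltr_pdivrMr// -[pi *+ 2 *~ m]mulrzl intrD mulrDl mulr2n.
  by lra.
rewrite /chord; move: (y + _ - x) => w wpi.
have -> : `|sin (w / 2)| = sin (`|w| / 2).
  rewrite -(ger0_norm (_ : 0 <= sin (`|w| / 2))).
    by case: (ger0P w) => // _; rewrite mulNr sinN normrN.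
  apply: sin_ge0_pi; have : `|w| <= pi by rewrite ler_norml.
  by have := normr_ge0 w; lra.
have wpi' : `|w| <= pi by rewrite ler_norml.
rewrite ltr_sin ?in_itv/=; last 2 first.
- by have := normr_ge0 w; lra.
- lra.
by rewrite ltr_pM2r// => /lt_le_trans; apply; rewrite ge_min lexx.
Qed.

End chord.
(** * Signed measures on the line modulo 2 pi *)

Section signed_measure.
Context d (T : measurableType d) (R : realType).
Variables (P N : {finite_measure set T -> \bar R}) (theta : T -> R).
Implicit Types f g : R -> R.

Definition bmf f := bounded_mfun (fun t => f (theta t)).

Definition signed_int f : R := \int[P]_t f (theta t) - \int[N]_t f (theta t).

(** When [P] and [N] are mutually singular, this is the integral of [|f|] against the total
    variation of [P - N]. *)
Definition var_int f : R := \int[P]_t `|f (theta t)| + \int[N]_t `|f (theta t)|.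

Lemma bmf_cst a : bmf (fun=> a).
Proof. exact: bounded_mfun_cst. Qed.

Lemma bmfD f g : bmf f -> bmf g -> bmf (fun x => f x + g x).
Proof. exact: bounded_mfunD. Qed.

Lemma bmfM f g : bmf f -> bmf g -> bmf (fun x => f x * g x).
Proof. exact: bounded_mfunM. Qed.

Lemma bmfB f g : bmf f -> bmf g -> bmf (fun x => f x - g x).
Proof.
move=> gf gg; under eq_fun do rewrite -mulN1r.
by apply: bmfD => //; apply: bmfM => //; exact: bmf_cst.
Qed.

Lemma signed_intD f g : bmf f -> bmf g ->
  signed_int (fun x => f x + g x) = signed_int f + signed_int g.
Proof.
move=> gf gg; rewrite /signed_int !RintegralD ?opprD 1?addrACA//;
  exact: bounded_mfun_integrable.
Qed.

Lemma signed_intZ a f : bmf f -> signed_int (fun x => a * f x) = a * signed_int f.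
Proof.
move=> gf; rewrite /signed_int !RintegralZl ?mulrBr//; exact: bounded_mfun_integrable.
Qed.

Lemma signed_intB f g : bmf f -> bmf g ->
  signed_int (fun x => f x - g x) = signed_int f - signed_int g.
Proof.
move=> gf gg; under eq_fun do rewrite -mulN1r.
rewrite signed_intD//; last by apply: bmfM => //; exact: bmf_cst.
by rewrite signed_intZ// mulN1r.
Qed.

Lemma norm_signed_int_le f : bmf f -> `|signed_int f| <= var_int f.
Proof.
move=> gf; rewrite (le_trans (ler_normB _ _))// lerD// le_normr_Rintegral//;
  exact: bounded_mfun_integrable.
Qed.

Lemma var_int_le f g : bmf f -> bmf g -> (forall x, `|f x| <= `|g x|) ->
  var_int f <= var_int g.
Proof.
move=> gf gg fg; apply: lerD; apply: le_Rintegral => //;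
  by apply: bounded_mfun_integrable; exact: bounded_mfun_norm.
Qed.

Lemma var_int_ge0 f : 0 <= var_int f.
Proof. by rewrite addr_ge0// Rintegral_ge0. Qed.

Lemma var_int_dominated_cvg0 (f_ : nat -> R -> R) (M : R) :
  (forall n, bmf (f_ n)) ->
  {ae P, forall t n, `|f_ n (theta t)| <= M} ->
  {ae N, forall t n, `|f_ n (theta t)| <= M} ->
  (forall x, f_ n x @[n --> \oo] --> (0 : R)) ->
  var_int (f_ n) @[n --> \oo] --> (0 : R).
Proof.
move=> gf PM NM f0; rewrite -[0]addr0; apply: cvgD;
  apply: (@Rintegral_dominated_cvg0 _ _ _ _ _ M) => //;
  by [move=> n; case: (gf n)|exact: aeW].
Qed.

Lemma signed_int_dominated_cvg0 (f_ : nat -> R -> R) (M : R) :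
  (forall n, bmf (f_ n)) ->
  {ae P, forall t n, `|f_ n (theta t)| <= M} ->
  {ae N, forall t n, `|f_ n (theta t)| <= M} ->
  (forall x, f_ n x @[n --> \oo] --> (0 : R)) ->
  signed_int (f_ n) @[n --> \oo] --> (0 : R).
Proof.
move=> gf PM NM f0; apply/norm_cvg0P.
apply: (squeeze_cvgr _ (cvg_cst 0) (var_int_dominated_cvg0 gf PM NM f0)).
by apply: nearW => n; rewrite normr_ge0 norm_signed_int_le.
Qed.

Lemma bmf_lim (f_ : nat -> R -> R) f (M : R) :
  (forall n, bmf (f_ n)) -> (forall n t, `|f_ n (theta t)| <= M) ->
  (forall x, f_ n x @[n --> \oo] --> f x) -> bmf f /\ forall t, `|f (theta t)| <= M.
Proof.
move=> gf fM ff.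
have fM' t : `|f (theta t)| <= M.
  by apply: ler_cvg_to (cvg_norm (ff (theta t))) (cvg_cst M) _; exact: nearW.
split=> //; split; last by exists M.
apply: (@measurable_fun_cvg _ _ _ _ (fun n t => f_ n (theta t))) => //.
by move=> n; case: (gf n).
Qed.

(** On the circle [theta] selects an arbitrary representative, so measurability is asked only after
    composition with a continuous periodic function. *)
Hypothesis measurable_theta : forall f, continuous f ->
  periodic f (pi *+ 2) -> measurable_fun setT (fun t => f (theta t)).

Lemma bmf_cos n y : bmf (fun x => cos (n%:R * x - y)).
Proof.
split; last by exists 1 => t; exact: cos_max.
apply: (measurable_theta (f := fun x => cos (n%:R * x - y))).
  move=> x; apply: continuous_comp; last exact: continuous_cos.
  by apply: cvgB; [apply: cvgM; [exact: cvg_cst|exact: cvg_id]|exact: cvg_cst].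
move=> x; rewrite mulrDr [n%:R * (pi *+ 2)]mulr_natl addrAC.
by rewrite periodicn//; exact: cosD2pi.
Qed.

Lemma bmf_cos1 y : bmf (fun x => cos (x - y)).
Proof. by have := bmf_cos 1 y; under eq_fun do rewrite mul1r. Qed.

Lemma bmfM_cos f n y : bmf f -> bmf (fun x => f x * cos (n%:R * x - y)).
Proof. by move=> gf; apply: bmfM => //; exact: bmf_cos. Qed.

(** * Functions with the Riemann-Lebesgue property *)

(* Allowing the phase to vary with [n] covers at once the sine coefficients and
   the products of [f] with trigonometric polynomials. *)
Definition rajchman f := bmf f /\ forall y : nat -> R,
  signed_int (fun x => f x * cos (n%:R * x - y n)) @[n --> \oo] --> (0 : R).

Lemma rajchmanD f g : rajchman f -> rajchman g ->
  rajchman (fun x => f x + g x).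
Proof.
move=> [gf rf] [gg rg]; split=> [|y]; first exact: bmfD.
have E n : signed_int (fun x => (f x + g x) * cos (n%:R * x - y n)) =
    signed_int (fun x => f x * cos (n%:R * x - y n)) +
    signed_int (fun x => g x * cos (n%:R * x - y n)).
  rewrite -signed_intD; try exact: bmfM_cos.
  by congr signed_int; apply/funext => x; rewrite mulrDl.
by apply: (eq_cvgn E); rewrite -[0]addr0; apply: cvgD; [exact: rf|exact: rg].
Qed.

Lemma rajchmanZ a f : rajchman f -> rajchman (fun x => a * f x).
Proof.
move=> [gf rf]; split=> [|y]; first by apply: bmfM => //; exact: bmf_cst.
have E n : signed_int (fun x => a * f x * cos (n%:R * x - y n)) =
    a * signed_int (fun x => f x * cos (n%:R * x - y n)).
  rewrite -signed_intZ; last exact: bmfM_cos.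
  by congr signed_int; apply/funext => x; rewrite mulrA.
by apply: (eq_cvgn E); rewrite -[0](mulr0 a); apply: cvgMl_tmp; exact: rf.
Qed.

(** The product formula moves the frequency by one in both directions and changes the phase by [z];
    arbitrary phases are allowed by [rajchman]. *)
Lemma rajchman_cos f z : rajchman f -> rajchman (fun x => f x * cos (x - z)).
Proof.
move=> [gf rf]; split=> [|y]; first by apply: bmfM => //; exact: bmf_cos1.
(* The frequency is taken to be [n.+1] so that the lower one is the natural number [n]. *)
have E n : signed_int (fun x => f x * cos (x - z) * cos (n.+1%:R * x - y n.+1)) =
    2^-1 * (signed_int (fun x => f x * cos (n.+2%:R * x - (y n.+1 + z))) +
            signed_int (fun x => f x * cos (n%:R * x - (y n.+1 - z)))).
  rewrite -signed_intD; try exact: bmfM_cos.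
  rewrite -signed_intZ; last by apply: bmfD; exact: bmfM_cos.
  congr signed_int; apply/funext => x.
  have -> : n.+2%:R * x - (y n.+1 + z) = (n.+1%:R * x - y n.+1) + (x - z).
    by rewrite -(natr1 n.+1); ring.
  have -> : n%:R * x - (y n.+1 - z) = (n.+1%:R * x - y n.+1) - (x - z).
    by rewrite -(natr1 n); ring.
  move: (n.+1%:R * x - y n.+1) (x - z) => a b.
  by rewrite cosD cosB; field.
rewrite -cvg_shiftS; apply: (eq_cvgn E).
rewrite -[0](mulr0 2^-1); apply: cvgMl_tmp; rewrite -[0]addr0; apply: cvgD.
  (* After two shifts of the index the phase [y n.-1] becomes the required [y n.+1]. *)
  have := rf (fun n => y n.-1 + z).
  by rewrite -cvg_shiftS -cvg_shiftS.
exact: (rf (fun n => y n.+1 - z)).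
Qed.

(** By dominated convergence some [f_ j] is close to [f] in [var_int]; as cosines are bounded by 1,
    this error is uniform in frequency and phase. *)
Lemma rajchman_lim (f_ : nat -> R -> R) f (M : R) :
  (forall n, rajchman (f_ n)) -> (forall n t, `|f_ n (theta t)| <= M) ->
  (forall x, f_ n x @[n --> \oo] --> f x) -> rajchman f.
Proof.
move=> rf fM ff.
have [gf fM'] : bmf f /\ forall t, `|f (theta t)| <= M.
  by apply: (bmf_lim _ fM ff) => n; case: (rf n).
have gfn n : bmf (f_ n) by case: (rf n).
split=> // y; apply/cvgr0Pnorm_lt => e e0.
have /cvgr0Pnorm_lt/(_ (e / 2)) :
    var_int (fun x => f_ n x - f x) @[n --> \oo] --> (0 : R).
  have b n t : `|f_ n (theta t) - f (theta t)| <= M + M.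
    by rewrite (le_trans (ler_normB _ _))// lerD.
  apply: (@var_int_dominated_cvg0 _ (M + M)) => [n|||x].
  - exact: bmfB.
  - by apply: aeW => t n; exact: b.
  - by apply: aeW => t n; exact: b.
  - by apply/subr_cvg0; exact: ff.
rewrite divr_gt0// => /(_ isT)[j _ /(_ j (leqnn _))/= vj].
have /cvgr0Pnorm_lt/(_ (e / 2)) := (rf j).2 y.
rewrite divr_gt0// => /(_ isT); apply: filterS => n /= snj.
have -> : signed_int (fun x => f x * cos (n%:R * x - y n)) =
    signed_int (fun x => f_ j x * cos (n%:R * x - y n)) -
    signed_int (fun x => (f_ j x - f x) * cos (n%:R * x - y n)).
  rewrite -signed_intB; try (apply: bmfM_cos => //; exact: bmfB).
  by congr signed_int; apply/funext => x; ring.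
rewrite (le_lt_trans (ler_normB _ _))// (splitr e) ltrD//.
apply: le_lt_trans vj; rewrite [leRHS]ger0_norm ?var_int_ge0//.
have gj : bmf (fun x => f_ j x - f x) by exact: bmfB.
apply: le_trans (norm_signed_int_le _) _; first exact: bmfM_cos.
apply: var_int_le => //; first exact: bmfM_cos.
by move=> x; rewrite normrM ler_piMr// cos_max.
Qed.

(** * Multipliers of the Riemann-Lebesgue class *)

(** These functions form an algebra closed under bounded pointwise limits and containing the
    translates of the cosine. Nonsmooth cut-offs are reached this way without any estimate on their
    Fourier coefficients. *)
Definition multiplier m :=
  bmf m /\ forall f, rajchman f -> rajchman (fun x => f x * m x).

Lemma multiplier_cst a : multiplier (fun=> a).
Proof.
split=> [|f rf]; first exact: bmf_cst.
by under eq_fun do rewrite mulrC; exact: rajchmanZ.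
Qed.

Lemma multiplierD m m' : multiplier m -> multiplier m' ->
  multiplier (fun x => m x + m' x).
Proof.
move=> [gm rm] [gm' rm']; split=> [|f rf]; first exact: bmfD.
by under eq_fun do rewrite mulrDr; apply: rajchmanD; [exact: rm|exact: rm'].
Qed.

Lemma multiplierM m m' : multiplier m -> multiplier m' ->
  multiplier (fun x => m x * m' x).
Proof.
move=> [gm rm] [gm' rm']; split=> [|f rf]; first exact: bmfM.
by under eq_fun do rewrite mulrA; apply: rm'; exact: rm.
Qed.

Lemma multiplierZ a m : multiplier m -> multiplier (fun x => a * m x).
Proof. by move=> mm; apply: multiplierM => //; exact: multiplier_cst. Qed.

Lemma multiplierB m m' : multiplier m -> multiplier m' ->
  multiplier (fun x => m x - m' x).
Proof.
move=> mm mm'; under eq_fun do rewrite -mulN1r.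
by apply: multiplierD => //; exact: multiplierZ.
Qed.

Lemma multiplierX m n : multiplier m -> multiplier (fun x => m x ^+ n).
Proof.
move=> mm; elim: n => [|n IH]; first exact: multiplier_cst.
by under eq_fun do rewrite exprS; exact: multiplierM.
Qed.

Lemma multiplier_cos z : multiplier (fun x => cos (x - z)).
Proof. by split=> [|f]; [exact: bmf_cos1|exact: rajchman_cos]. Qed.

Lemma multiplier_lim (m_ : nat -> R -> R) m (M : R) :
  (forall n, multiplier (m_ n)) -> (forall n t, `|m_ n (theta t)| <= M) ->
  (forall x, m_ n x @[n --> \oo] --> m x) -> multiplier m.
Proof.
move=> mm mM m_m.
have [gm _] : bmf m /\ forall t, `|m (theta t)| <= M.
  by apply: (bmf_lim _ mM m_m) => n; case: (mm n).
split=> // f rf; have [[_ [B fB]] _] := rf.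
apply: (@rajchman_lim (fun n x => f x * m_ n x) _ (B * M)).
- by move=> n; apply: (mm n).2.
- by move=> n t; rewrite normrM ler_pM.
- by move=> x; apply: cvgMl_tmp; exact: m_m.
Qed.

Lemma multiplier_sg w : multiplier w -> (forall x, `|w x| <= 1) ->
  multiplier (fun x => Num.sg (w x)).
Proof.
move=> mw w1; apply: (@multiplier_lim (fun n x => iter n (@sgstep R) (w x)) _ 1).
- elim=> //= n IH; rewrite /sgstep; under eq_fun do rewrite mulrC.
  by apply: multiplierZ; apply: multiplierB; [exact: multiplierZ|exact: multiplierX].
- by move=> n t; exact: norm_iter_sgstep.
- by move=> x; exact: cvg_iter_sgstep.
Qed.

(** The positive part is [(w + |w|) / 2], and [|w|] is [w] times its sign, a bounded limit of
    polynomials in [w]. *)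
Lemma multiplier_max0 w : multiplier w -> (forall x, `|w x| <= 1) ->
  multiplier (fun x => Num.max 0 (w x)).
Proof.
move=> mw w1; rewrite (_ : (fun x => _) = fun x => 2^-1 * (w x + w x * Num.sg (w x))).
  apply: multiplierZ; apply: multiplierD => //; apply: multiplierM => //.
  exact: multiplier_sg.
apply/funext => x; case: (ltgtP (w x) 0) => [w0|w0|->].
- by rewrite ltr0_sg//; ring.
- by rewrite gtr0_sg//; field.
- by rewrite sgr0; ring.
Qed.

Lemma multiplier_chord_sqr x : multiplier (fun y => chord x y ^+ 2).
Proof.
under eq_fun do rewrite chord_sqr.
apply: multiplierB; first exact: multiplier_cst.
by apply: multiplierZ; exact: multiplier_cos.
Qed.

(** * Localization of Dirichlet integrals *)

Lemma bmf_dirichlet n x : bmf (fun y => dirichlet n (x - y)).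
Proof.
elim: n => [|n IH].
  by rewrite /dirichlet; under eq_fun do rewrite big_ord0; exact: bmf_cst.
under eq_fun do rewrite dirichletS -cosN -mulrN opprB mulrBr.
by apply: bmfD => //; apply: bmfM; [exact: bmf_cst|exact: bmf_cos].
Qed.

(* The kernel [dirichlet n] times [chord ^+ 2] is a difference of two cosines, so
   the integral of [f * dirichlet n * (1 - (1 - chord ^+ 2) ^+ N)] vanishes in
   the limit by the Riemann-Lebesgue property of [f]; the rest is dominated by
   [C * (1 - chord ^+ 2) ^+ N] off the zeros of [chord], uniformly in [n]. *)
Lemma dirichlet_localization f x C :
  rajchman f -> (forall y, `|f y| <= C * chord x y) ->
  signed_int (fun y => f y * dirichlet n (x - y)) @[n --> \oo] --> (0 : R).
Proof.
move=> rf fC; have gf := rf.1.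
have C0 : 0 <= C.
  (* At the antipode of [x] the chord is 1, so the bound there forces [C >= 0]. *)
  have := fC (x + pi); rewrite /chord addrAC subrr add0r sin_pihalf normr1 mulr1.
  exact: le_trans.
pose u y := chord x y ^+ 2.
have mu : multiplier u by exact: multiplier_chord_sqr.
have u0 y : 0 <= u y by rewrite sqr_ge0.
have u1 y : u y <= 1 by apply: exprn_ile1; [exact: normr_ge0|exact: chord_le1].
(* The geometric sum gives [u * q k = 1 - (1 - u) ^+ k], which isolates a factor [u] to cancel the
   singularity of the kernel. *)
pose q k y := \sum_(i < k) (1 - u y) ^+ i.
have mq k : multiplier (q k).
  elim: k => [|k IH]; rewrite /q.
    by under eq_fun do rewrite big_ord0; exact: multiplier_cst.
  under eq_fun do rewrite big_ord_recr; apply: multiplierD => //.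
  by apply: multiplierX; apply: multiplierB => //; exact: multiplier_cst.
(* The sign factor is 0 at the zeros of [u], where the power stays equal to 1 but [f] vanishes; with
   it [b k] tends to 0 everywhere. *)
pose b k y := C * (1 - u y) ^+ k * Num.sg (u y).
have mb k : multiplier (b k).
  apply: multiplierM; last by apply: multiplier_sg => // y; rewrite ger0_norm.
  apply: multiplierZ; apply: multiplierX; apply: multiplierB => //.
  exact: multiplier_cst.
have b0 k y : 0 <= b k y.
  by rewrite !mulr_ge0 ?exprn_ge0 ?subr_ge0 ?sgr_ge0.
have bC k y : `|b k y| <= C.
  rewrite ger0_norm// /b -mulrA ler_piMr// mulr_ile1 ?exprn_ge0 ?subr_ge0 ?sgr_ge0//.
    by rewrite exprn_ile1 ?subr_ge0// lerBlDr lerDl.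
  by rewrite (le_trans (ler_norm _))// normr_sg; case: eqP.
have vb : var_int (b k) @[k --> \oo] --> (0 : R).
  apply: (@var_int_dominated_cvg0 _ C) => [k|||y].
  - exact: (mb k).1.
  - exact: aeW.
  - exact: aeW.
  - have [uy|uy] := eqVneq (u y) 0.
      apply: (@eq_cvgn _ (fun=> 0)); last exact: cvg_cst.
      by move=> k; rewrite /b uy sgr0 mulr0.
    apply: (@eq_cvgn _ (geometric C (1 - u y))).
      by move=> k; rewrite /b gtr0_sg ?mulr1// lt_neqAle eq_sym uy u0.
    apply: cvg_geometric; have : 0 < u y by rewrite lt_neqAle eq_sym uy u0.
    by have := u1 y; rewrite ltr_norml; lra.
have fb n k y : `|f y * dirichlet n (x - y) * (1 - u y) ^+ k| <= b k y.
  have [uy|uy] := eqVneq (u y) 0.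
    suff -> : f y = 0 by rewrite !mul0r normr0.
    apply/eqP; rewrite -normr_le0 (le_trans (fC y))//.
    by move/eqP: uy; rewrite /u sqrf_eq0 => /eqP ->; rewrite mulr0.
  have uy0 : 0 < u y by rewrite lt_neqAle eq_sym uy u0.
  rewrite /b gtr0_sg// mulr1 normrM [X in _ * X]ger0_norm ?exprn_ge0 ?subr_ge0//.
  rewrite ler_wpM2r ?exprn_ge0 ?subr_ge0// normrM.
  apply: (@le_trans _ _ (C * chord y x * `|dirichlet n (x - y)|)).
    by rewrite ler_wpM2r// chordC.
  rewrite -mulrA ler_piMr// -normrM mulrC dirichlet_sin.
  exact: sin_max.
have split n k : signed_int (fun y => f y * dirichlet n (x - y)) =
    signed_int (fun y => f y * q k y * dirichlet n (x - y) * u y) +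
    signed_int (fun y => f y * dirichlet n (x - y) * (1 - u y) ^+ k).
  have gd := bmf_dirichlet n x.
  rewrite -signed_intD.
  - congr signed_int; apply/funext => y.
    have : (1 - u y) ^+ k = 1 - u y * q k y.
      have := subrX1 (1 - u y) k; rewrite -/(q k y) => e.
      by apply/eqP; rewrite -subr_eq0; apply/eqP; move: e; lra.
    by move=> ->; ring.
  - apply: bmfM mu.1; apply: bmfM gd; apply: bmfM => //; exact: (mq k).1.
  - apply: bmfM; first exact: bmfM.
    suff : multiplier (fun y => (1 - u y) ^+ k) by case.
    by apply: multiplierX; apply: multiplierB => //; exact: multiplier_cst.
have main k : signed_int (fun y => f y * q k y * dirichlet n (x - y) * u y)
    @[n --> \oo] --> (0 : R).
  have [gfq rfq] := (mq k).2 _ rf.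
  apply: (@eq_cvgn _ (fun n =>
    2^-1 * (signed_int (fun y => f y * q k y * cos (n%:R * y - n%:R * x)) -
            signed_int (fun y => f y * q k y * cos (n.+1%:R * y - n.+1%:R * x))))) => [n|].
    rewrite -signed_intB; try exact: bmfM_cos.
    rewrite -signed_intZ; last by apply: bmfB; exact: bmfM_cos.
    congr signed_int; apply/funext => y.
    have -> : u y = sin ((x - y) / 2) ^+ 2.
      by rewrite /u chordC real_normK ?num_real.
    rewrite -mulrA dirichlet_sin2.
    by rewrite -(cosN (n%:R * y - _)) -(cosN (n.+1%:R * y - _)) !opprB -!mulrBr; field.
  rewrite -[0](mulr0 2^-1); apply: cvgMl_tmp; rewrite -[0]subr0; apply: cvgB.
    exact: (rfq (fun n => n%:R * x)).
  have := rfq (fun n => n%:R * x).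
  by rewrite -cvg_shiftS.
apply/cvgr0Pnorm_lt => e e0.
have e20 : 0 < e / 2 by rewrite divr_gt0.
(* First [k] is fixed, making the remainder small for all [n] at once; only then is [n] taken
   large. *)
have /cvgr0Pnorm_lt/(_ _ e20)[k _ /(_ k (leqnn _))/= vk] := vb.
have /cvgr0Pnorm_lt/(_ _ e20) := main k; apply: filterS => n mn.
rewrite (split n k) (le_lt_trans (ler_normD _ _))// (splitr e) ltrD//.
apply: le_lt_trans vk; rewrite [leRHS]ger0_norm ?var_int_ge0//.
have g3 : bmf (fun y => f y * dirichlet n (x - y) * (1 - u y) ^+ k).
  apply: bmfM; first by apply: bmfM => //; exact: bmf_dirichlet.
  suff : multiplier (fun y => (1 - u y) ^+ k) by case.
  by apply: multiplierX; apply: multiplierB => //; exact: multiplier_cst.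
apply: le_trans (norm_signed_int_le g3) _; apply: var_int_le => //; first exact: (mb k).1.
by move=> y; rewrite (le_trans (fb _ _ _))// ler_norm.
Qed.

(** * Partial Fourier sums as Dirichlet integrals *)

(** This is 2 pi times the n-th partial Fourier sum of [f] times the signed measure. *)
Definition fsum f n x : R := signed_int (fun y => f y * dirichlet n (x - y)).

(** Phase 0 gives the cosine integrals and phase [pi / 2] the sine integrals. *)
Let fcos f m z := signed_int (fun y => f y * cos (m%:R * y - z)).

Lemma fsum0 f : fsum f 0 = fun=> signed_int f.
Proof.
apply/funext => x; congr signed_int; apply/funext => y.
by rewrite /dirichlet big_ord0 addr0 mulr1.
Qed.

(** Splitting off the top frequency displays the sum as a trigonometric polynomial in [x];
    boundedness, continuity and the square estimate then follow by induction, without Fubini. *)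
Lemma fsumS f n : bmf f -> fsum f n.+1 = fun x => fsum f n x +
  (2 * fcos f n.+1 0 * cos (n.+1%:R * x - 0) +
   2 * fcos f n.+1 (pi / 2) * cos (n.+1%:R * x - pi / 2)).
Proof.
move=> gf; have gc z := bmfM_cos n.+1 z gf.
have gZ a z : bmf (fun y => a * (f y * cos (n.+1%:R * y - z))).
  by apply: bmfM => //; exact: bmf_cst.
apply/funext => x.
rewrite [2 * fcos _ _ 0 * _]mulrAC [2 * fcos _ _ (pi / 2) * _]mulrAC.
rewrite -!signed_intZ// -!signed_intD//; last 2 first.
- by apply: bmfM => //; exact: bmf_dirichlet.
- exact: bmfD.
congr signed_int; apply/funext => y; rewrite dirichletS subr0.
by rewrite !cosBpihalf subr0 [_ * (x - y)]mulrBr cosB; ring.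
Qed.

Lemma bmf_fsum f n : bmf f -> bmf (fsum f n).
Proof.
move=> gf; elim: n => [|n IH].
  by rewrite fsum0; exact: bmf_cst.
rewrite fsumS//.
by apply: bmfD => //; apply: bmfD; apply: bmfM; (exact: bmf_cst || exact: bmf_cos).
Qed.

Lemma continuous_fsum f n : bmf f -> continuous (fsum f n).
Proof.
move=> gf; have cc m z : continuous (fun x : R => cos (m%:R * x - z)).
  move=> x; apply: continuous_comp; last exact: continuous_cos.
  by apply: cvgB; [apply: cvgM; [exact: cvg_cst|exact: cvg_id]|exact: cvg_cst].
elim: n => [|n IH].
  by rewrite fsum0 => x; exact: cvg_cst.
rewrite fsumS// => x; apply: cvgD; first exact: IH.
by apply: cvgD; apply: cvgMl_tmp; exact: cc.
Qed.

Lemma periodic_fsum f n : periodic (fsum f n) (pi *+ 2).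
Proof.
move=> x; congr signed_int; apply/funext => y; congr (_ * _); congr (1 + _).
apply: eq_bigr => l _; rewrite addrAC mulrDr [_ * (pi *+ 2)]mulr_natl.
by rewrite periodicn//; exact: cosD2pi.
Qed.

(* The right-hand side is the sum of the squares of the cosine and sine integrals
   of [f] up to order [n], the nonconstant ones being counted twice. *)
Lemma sqr_signed_int_le f n : bmf f ->
  signed_int f ^+ 2 <= signed_int (fun x => f x * fsum f n x).
Proof.
move=> gf; elim: n => [|n IH].
  rewrite fsum0; under eq_fun do rewrite mulrC.
  by rewrite signed_intZ// expr2.
apply: le_trans IH _.
pose c := fcos f n.+1 0; pose s := fcos f n.+1 (pi / 2).
have gc z := bmfM_cos n.+1 z gf.
have gZ a z : bmf (fun y => a * (f y * cos (n.+1%:R * y - z))).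
  by apply: bmfM => //; exact: bmf_cst.
have -> : signed_int (fun x => f x * fsum f n.+1 x) =
    signed_int (fun x => f x * fsum f n x) + (2 * c * c + 2 * s * s).
  rewrite -[2 * c * c]signed_intZ// -[2 * s * s]signed_intZ// -!signed_intD//; last 2 first.
  - by apply: bmfM => //; exact: bmf_fsum.
  - exact: bmfD.
  by congr signed_int; apply/funext => y; rewrite fsumS// -/c -/s; ring.
by rewrite lerDl -!mulrA -!expr2 addr_ge0// mulr_ge0// sqr_ge0.
Qed.

(** * Lipschitz cut-off functions *)

(** The first two clauses are those that localization consumes, the Lipschitz bound absorbing one
    factor of the kernel's singularity. The range [0, 1] makes products and complements stay in the
    class. *)
Definition bump f := [/\ multiplier f,
  exists C, forall x y, `|f y - f x| <= C * chord x y &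
  forall x, 0 <= f x <= 1].

Lemma bump_compl f : bump f -> bump (fun x => 1 - f x).
Proof.
move=> [mf [C fC] f01]; split.
- by apply: multiplierB => //; exact: multiplier_cst.
- by exists C => x y; rewrite opprB addrC addrA subrK distrC.
- by move=> x; have := f01 x; lra.
Qed.

Lemma bumpM f g : bump f -> bump g -> bump (fun x => f x * g x).
Proof.
move=> [mf [C fC] f01] [mg [D gD] g01]; split; first exact: multiplierM.
  exists (C + D) => x y.
  rewrite (_ : _ - _ = (f y - f x) * g y + f x * (g y - g x)); last by ring.
  rewrite (le_trans (ler_normD _ _))// !normrM mulrDl.
  have /andP[fx0 fx1] := f01 x; have /andP[gy0 gy1] := g01 y.
  rewrite (ger0_norm fx0) (ger0_norm gy0) lerD//.
    by rewrite (le_trans _ (fC x y))// ler_piMr.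
  by rewrite (le_trans _ (gD x y))// ler_piMl.
move=> x; have /andP[fx0 fx1] := f01 x; have /andP[gx0 gx1] := g01 x.
by rewrite mulr_ge0//= mulr_ile1.
Qed.

Lemma bump1 : bump (fun=> 1).
Proof.
split; [exact: multiplier_cst| |by move=> x; rewrite ler01 lexx].
by exists 0 => x y; rewrite subrr normr0 mul0r.
Qed.

Lemma bumpX f n : bump f -> bump (fun x => f x ^+ n).
Proof.
move=> bf; elim: n => [|n IH]; first exact: bump1.
by under eq_fun do rewrite exprS; exact: bumpM.
Qed.

(** The positive part of a trigonometric polynomial, positive exactly on the arc of chordal radius
    [r] about [x] when [r >= 0]. *)
Definition arc_bump x r (y : R) : R := Num.max 0 (r ^+ 2 - chord x y ^+ 2).

Lemma arc_bump_gt0 x r y : 0 <= r -> (0 < arc_bump x r y) = (chord x y < r).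
Proof.
move=> r0; rewrite /arc_bump lt_max ltxx/= subr_gt0 ltr_pXn2r// ?nnegrE//.
exact: normr_ge0.
Qed.

Lemma bump_arc_bump x r : 0 <= r <= 1 -> bump (arc_bump x r).
Proof.
move=> /andP[r0 r1].
have r21 : r ^+ 2 <= 1 by rewrite exprn_ile1.
have c0 y : 0 <= chord x y ^+ 2 by rewrite sqr_ge0.
have c1 y : chord x y ^+ 2 <= 1.
  by apply: exprn_ile1; [exact: normr_ge0|exact: chord_le1].
have r20 : 0 <= r ^+ 2 by rewrite sqr_ge0.
split.
- apply: multiplier_max0 => [|y].
    by apply: multiplierB; [exact: multiplier_cst|exact: multiplier_chord_sqr].
  by have := c0 y; have := c1 y; rewrite ler_norml; lra.
(* In the difference of two squared chords, the sum of the chords is at most 2 and their difference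
   at most [chord y z]. *)
- exists 2 => y z; rewrite /arc_bump.
  have : `|chord x y ^+ 2 - chord x z ^+ 2| <= 2 * chord y z.
    rewrite subr_sqr normrM mulrC ler_pM//.
      rewrite (le_trans (ler_normD _ _))// !ger0_norm; try exact: normr_ge0.
      by have := chord_le1 x y; have := chord_le1 x z; lra.
    have := chord_triangle z x y; have := chord_triangle y x z.
    by rewrite (chordC z y) => h1 h2; rewrite ler_norml; lra.
  rewrite !ler_norml => /andP[h1 h2].
  case: (leP 0 (r ^+ 2 - chord x z ^+ 2)) => h3;
    by case: (leP 0 (r ^+ 2 - chord x y ^+ 2)) => h4; lra.
- move=> y; rewrite /arc_bump le_max lexx/= ge_max ler01/=.
  by have := c0 y; lra.
Qed.

(** * Rajchman's localization principle *)

Lemma bmf_cosn n : bmf (fun y => cos (n%:R * y)).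
Proof. by have := bmf_cos n 0; under eq_fun do rewrite subr0. Qed.

Lemma bmf_sinn n : bmf (fun y => sin (n%:R * y)).
Proof. by have := bmf_cos n (pi / 2); under eq_fun do rewrite cosBpihalf. Qed.

Lemma fsum1E n x : fsum (fun=> 1) n x = signed_int (fun=> 1) + \sum_(l < n) 2 *
  (signed_int (fun y => cos (l.+1%:R * y)) * cos (l.+1%:R * x) +
   signed_int (fun y => sin (l.+1%:R * y)) * sin (l.+1%:R * x)).
Proof.
elim: n => [|n IH]; first by rewrite fsum0 big_ord0 addr0.
rewrite fsumS; last exact: bmf_cst.
rewrite IH big_ord_recr [RHS]addrA; congr (_ + _).
have -> : fcos (fun=> 1) n.+1 0 = signed_int (fun y => cos (n.+1%:R * y)).
  by congr signed_int; apply/funext => y; rewrite mul1r subr0.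
have -> : fcos (fun=> 1) n.+1 (pi / 2) = signed_int (fun y => sin (n.+1%:R * y)).
  by congr signed_int; apply/funext => y; rewrite mul1r cosBpihalf.
by rewrite cosBpihalf subr0 -!mulrA -mulrDr.
Qed.

(** The addition formula separates the phase, whose cosine and sine are bounded by 1 however it
    varies with [n]. *)
Lemma rajchman_cst1 :
  signed_int (fun y => cos (n%:R * y)) @[n --> \oo] --> (0 : R) ->
  signed_int (fun y => sin (n%:R * y)) @[n --> \oo] --> (0 : R) ->
  rajchman (fun=> 1).
Proof.
move=> c0 s0; split=> [|y]; first exact: bmf_cst.
have E n : signed_int (fun x => 1 * cos (n%:R * x - y n)) =
    cos (y n) * signed_int (fun x => cos (n%:R * x)) +
    sin (y n) * signed_int (fun x => sin (n%:R * x)).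
  have gc := bmf_cosn n; have gs := bmf_sinn n.
  rewrite -!signed_intZ// -signed_intD; try (apply: bmfM => //; exact: bmf_cst).
  by congr signed_int; apply/funext => x; rewrite cosB; ring.
apply: (eq_cvgn E); apply/norm_cvg0P.
have cs0 : `|signed_int (fun y => cos (n%:R * y))| + `|signed_int (fun y => sin (n%:R * y))|
    @[n --> \oo] --> (0 : R).
  by rewrite -[0]addr0; apply: cvgD; exact/norm_cvg0P.
apply: (squeeze_cvgr _ (cvg_cst 0) cs0).
apply: nearW => n; rewrite normr_ge0/= (le_trans (ler_normD _ _))// !normrM.
by apply: lerD; rewrite ler_piMl ?cos_max ?sin_max.
Qed.

Lemma fsum_mul_diff f n x : bmf f -> fsum f n x - f x * fsum (fun=> 1) n x =
  signed_int (fun y => (f y - f x) * dirichlet n (x - y)).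
Proof.
move=> gf; have gd := bmf_dirichlet n x.
rewrite -signed_intZ -?signed_intB; try (do ?apply: bmfM => //; exact: bmf_cst).
by congr signed_int; apply/funext => y; ring.
Qed.

(** The Lipschitz bound supplies a chord, and the kernel times the chord is a sine up to sign, so
    the integrand is at most [C] uniformly in [n] and [x]. *)
Lemma bump_fsum_bounded f : bump f ->
  exists B : R, forall n x, `|fsum f n x - f x * fsum (fun=> 1) n x| <= B.
Proof.
move=> [[gf _] [C fC] _]; exists (var_int (fun=> C)) => n x.
rewrite fsum_mul_diff//.
have g : bmf (fun y => (f y - f x) * dirichlet n (x - y)).
  apply: bmfM; last exact: bmf_dirichlet.
  by apply: bmfB => //; exact: bmf_cst.
apply: le_trans (norm_signed_int_le g) _; apply: var_int_le => //; first exact: bmf_cst.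
move=> y; rewrite normrM (le_trans _ (ler_norm _))//.
apply: (@le_trans _ _ (C * chord y x * `|dirichlet n (x - y)|)).
  by rewrite ler_wpM2r// chordC.
have C0 : 0 <= C.
  have := fC x (x + pi).
  rewrite /chord addrAC subrr add0r sin_pihalf normr1 mulr1.
  exact: le_trans.
rewrite -mulrA ler_piMr// -normrM mulrC dirichlet_sin.
exact: sin_max.
Qed.

Hypothesis rajchman1 : rajchman (fun=> 1).

(** [f - f x] is a multiplier applied to the constant 1 and is at most a multiple of the chord from
    [x], so localization applies. *)
Lemma bump_fsum_cvg f x : bump f ->
  fsum f n x - f x * fsum (fun=> 1) n x @[n --> \oo] --> (0 : R).
Proof.
move=> [mf [C fC] _].
apply: (eq_cvgn (fun n => fsum_mul_diff n x mf.1)).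
apply: (dirichlet_localization (C := C)) => //.
have : multiplier (fun y => f y - f x).
  by apply: multiplierB => //; exact: multiplier_cst.
by move=> [_ /(_ _ rajchman1)]; under eq_fun do rewrite mul1r.
Qed.

(** * Equality of [P] and [N] where the partial sums are bounded *)

Variable nn : nat -> nat.
Hypothesis nn_oo : nn k @[k --> \oo] --> \oo.
Hypothesis fsum_cvg0 : forall x,
  fsum (fun=> 1) (nn k) x @[k --> \oo] --> (0 : R).

(** Almost everywhere is essential: category gives the bound only at charged points, and the other
    points form a null set. *)
Definition fsum_bounded_on f (M : R) :=
  {ae P, forall t k, f (theta t) != 0 -> `|fsum (fun=> 1) (nn k) (theta t)| <= M} /\
  {ae N, forall t k, f (theta t) != 0 -> `|fsum (fun=> 1) (nn k) (theta t)| <= M}.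

Lemma bump_signed_int0 f (M : R) : bump f -> fsum_bounded_on f M -> signed_int f = 0.
Proof.
move=> bf [PM NM]; have [B fB] := bump_fsum_bounded bf.
have [[gf _] _ f01] := bf.
have bnd t : (forall k, f (theta t) != 0 ->
      `|fsum (fun=> 1) (nn k) (theta t)| <= M) ->
    forall k, `|f (theta t) * fsum f (nn k) (theta t)| <= `|M| + `|B|.
  move: (theta t) => x h k; have [->|/(h k) {}h] := eqVneq (f x) 0.
    by rewrite mul0r normr0 addr_ge0.
  have /andP[f0 f1] := f01 x.
  rewrite normrM (ger0_norm f0) (le_trans (ler_piMl _ f1))//.
  rewrite -(subrK (f x * fsum (fun=> 1) (nn k) x) (fsum f (nn k) x)).
  rewrite (le_trans (ler_normD _ _))// addrC lerD//.
    rewrite normrM (ger0_norm f0) (le_trans (ler_piMl _ f1))//.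
    by rewrite (le_trans h)// ler_norm.
  by rewrite (le_trans (fB _ _))// ler_norm.
have cvg0 : signed_int (fun x => f x * fsum f (nn k) x) @[k --> \oo] --> (0 : R).
  apply: (@signed_int_dominated_cvg0 _ (`|M| + `|B|)) => [k|||x].
  - by apply: bmfM => //; exact: bmf_fsum.
  - by apply: filterS PM; exact: bnd.
  - by apply: filterS NM; exact: bnd.
  (* The localization error tends to 0 by [bump_fsum_cvg], the remaining term by the hypothesis on
     the sums of the measure. *)
  - apply: (@eq_cvgn _ (fun k => f x * ((fsum f (nn k) x -
        f x * fsum (fun=> 1) (nn k) x) + f x * fsum (fun=> 1) (nn k) x))).
      by move=> k; rewrite subrK.
    rewrite -[0](mulr0 (f x)); apply: cvgMl_tmp; rewrite -[0]addr0; apply: cvgD.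
      exact: (cvg_comp _ _ nn_oo (bump_fsum_cvg x bf)).
    by rewrite -[0](mulr0 (f x)); apply: cvgMl_tmp; exact: fsum_cvg0.
apply/eqP; rewrite -sqrf_eq0 eq_le sqr_ge0 andbT.
apply: ler_cvg_to (cvg_cst (signed_int f ^+ 2)) cvg0 _.
by apply: nearW => k; exact: sqr_signed_int_le.
Qed.

Lemma measurable_bump_gt0 f : bump f ->
  measurable (theta @^-1` [set y | 0 < f y]).
Proof.
move=> [[[mf _] _] _ _]; rewrite -[X in measurable X]setTI.
rewrite (_ : theta @^-1` _ = (fun t => f (theta t)) @^-1` `]0, +oo[).
  exact: mf.
by apply/seteqP; split=> t /=; rewrite in_itv/= andbT.
Qed.

(* The indicator function of [0 < f] is the limit of [1 - (1 - f) ^+ j]. *)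
Lemma bump_measure_eq f (M : R) : bump f -> fsum_bounded_on f M ->
  P (theta @^-1` [set y | 0 < f y]) = N (theta @^-1` [set y | 0 < f y]).
Proof.
move=> bf [PM NM]; set A := theta @^-1` _.
have mA : measurable A by exact: measurable_bump_gt0.
have [mf _ f01] := bf.
pose h j x : R := 1 - (1 - f x) ^+ j.
have bh j : bump (h j).
  by apply: bump_compl; apply: bumpX; exact: bump_compl.
have hint0 j : signed_int (h j) = 0.
  apply: (@bump_signed_int0 _ M) => //.
  (* [h j] vanishes wherever [f] does, so it inherits the bound [M]. *)
  suff hf x : h j x != 0 -> f x != 0.
    by split; [move: PM|move: NM]; apply: filterS => t h1 k /hf; exact: h1.
  by apply: contraNneq => fx; rewrite /h fx subr0 expr1n subrr.
have msg : multiplier (fun x => Num.sg (f x)).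
  by apply: multiplier_sg => // x; have /andP[f0 f1] := f01 x; rewrite ger0_norm.
have sg01 x : 0 <= Num.sg (f x) <= 1.
  by have /andP[f0 _] := f01 x; rewrite sgr_ge0 f0/=; case: sgrP.
have : signed_int (fun x => h j x - Num.sg (f x)) @[j --> \oo] --> (0 : R).
  have b j x : `|h j x - Num.sg (f x)| <= 1.
    have [_ _ /(_ x)] := bh j; have := sg01 x.
    by rewrite ler_norml; lra.
  apply: (@signed_int_dominated_cvg0 _ 1) => [j|||x].
  - by apply: bmfB; [case: (bh j) => -[]|case: msg].
  - exact: aeW.
  - exact: aeW.
  - have [fx|fx] := eqVneq (f x) 0.
      apply: (@eq_cvgn _ (fun=> 0)); last exact: cvg_cst.
      by move=> j; rewrite /h fx sgr0 !subr0 expr1n subrr.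
    have /andP[f0 f1] := f01 x.
    have {}f0 : 0 < f x by rewrite lt_neqAle eq_sym fx.
    apply: (@eq_cvgn _ (fun j => - (geometric 1 (1 - f x) j))).
      by move=> j; rewrite /h gtr0_sg//=; ring.
    rewrite -oppr0; apply: cvgN; apply: cvg_geometric.
    by rewrite ltr_norml; lra.
move=> cv; have sg0 : signed_int (fun x => Num.sg (f x)) = 0.
  apply/eqP; rewrite -oppr_eq0; apply/eqP.
  apply: cvg_unique cv; first exact: Rhausdorff.
  apply: (@eq_cvgn _ (fun=> - signed_int (fun x => Num.sg (f x)))); last exact: cvg_cst.
  by move=> j; rewrite signed_intB ?hint0 ?sub0r//; [case: (bh j) => -[]|case: msg].
have I (m : {finite_measure set T -> \bar R}) :
    \int[m]_t Num.sg (f (theta t)) = fine (m A).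
  rewrite /Rintegral -[A in RHS]setIT -integral_indic//; congr fine.
  apply: eq_integral => t _; congr EFin; rewrite indicE.
  have /andP[f0 _] := f01 (theta t); have [fx|fx] := eqVneq (f (theta t)) 0.
    by rewrite fx sgr0 memNset// /A/= fx ltxx.
  have {}f0 : 0 < f (theta t) by rewrite lt_neqAle eq_sym fx.
  by rewrite gtr0_sg// mem_set.
move: sg0; rewrite /signed_int !I => /subr0_eq e.
by rewrite -[LHS]fineK ?fin_num_measure// e fineK// fin_num_measure.
Qed.

(** * Null arcs and charged points *)

Definition arc (x r : R) := theta @^-1` [set y | chord x y < r].

Definition null_arc x r := P (arc x r) = 0%E /\ N (arc x r) = 0%E.

Hypothesis measurable_arcs :
  @measurable _ T = <<s [set A | exists x r : R, 0 < r <= 1 /\ A = arc x r] >>.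

Hypothesis mutually_singular : forall U, measurable U ->
  (forall A, measurable A -> P (A `&` U) = N (A `&` U)) ->
  P U = 0%E /\ N U = 0%E.

Lemma arcE x r : 0 <= r -> arc x r = theta @^-1` [set y | 0 < arc_bump x r y].
Proof. by move=> r0; apply/seteqP; split=> t /=; rewrite arc_bump_gt0. Qed.

Lemma measurable_arc x r : 0 < r <= 1 -> measurable (arc x r).
Proof.
move=> /andP[r0 r1]; rewrite arcE ?ltW//; apply: measurable_bump_gt0.
by apply: bump_arc_bump; rewrite ltW.
Qed.

(** The positivity sets of bumps form a generating pi-system, products giving intersections. [P] and
    [N] agree on their traces on the arc, hence by Dynkin's theorem on all measurable subsets of it,
    and mutual singularity concludes. *)
Lemma null_arc_of_bounded x (r M : R) : 0 < r <= 1 ->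
  fsum_bounded_on (arc_bump x r) M -> null_arc x r.
Proof.
move=> r01 [PM NM]; have [r0 r1] := andP r01.
have bx : bump (arc_bump x r) by apply: bump_arc_bump; rewrite ltW.
have mU := measurable_arc x r01.
apply: mutually_singular => // A mA.
pose G := [set A | exists2 f, bump f & A = theta @^-1` [set y | 0 < f y]].
have mG : @measurable _ T = <<s G>>.
  apply/seteqP; split.
    rewrite measurable_arcs; apply: sub_sigma_algebra2.
    move=> _ [y [s [/andP[s0 s1] ->]]]; exists (arc_bump y s).
      by apply: bump_arc_bump; rewrite ltW.
    by rewrite arcE// ltW.
  apply: smallest_sub; first exact: sigma_algebra_measurable.
  by move=> _ [f bf ->]; exact: measurable_bump_gt0.
have IE f g : bump f -> bump g ->
    theta @^-1` [set y | 0 < f y] `&` theta @^-1` [set y | 0 < g y] =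
    theta @^-1` [set y | 0 < f y * g y].
  move=> [_ _ f01] [_ _ g01]; apply/seteqP; split=> t /=.
    by move=> [f0 g0]; rewrite mulr_gt0.
  have /andP[f0 _] := f01 (theta t); have /andP[g0 _] := g01 (theta t).
  by rewrite !lt_def mulf_eq0 negb_or f0 g0 => /andP[/andP[-> ->] _].
(* The factor [arc_bump] confines the product to the arc, where the bound [M] is available. *)
have restrict f : bump f -> fsum_bounded_on (fun y => f y * arc_bump x r y) M.
  move=> _; split; [move: PM|move: NM]; apply: filterS => t h k fx; apply: h;
  by apply: contraNneq fx => ->; rewrite mulr0.
have U_eq : P (arc x r) = N (arc x r).
  by rewrite arcE ?ltW//; apply: (@bump_measure_eq _ M).
rewrite mG in mA; move: A mA.
apply: (@dynkin_induction _ T G (fun A => P (A `&` arc x r) = N (A `&` arc x r))) => //.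
- move=> _ _ [f bf ->] [g bg ->]; exists (fun y => f y * g y); first exact: bumpM.
  exact: IE.
- by rewrite setTI.
- move=> _ [f bf ->]; rewrite arcE ?ltW// IE//.
  by apply: (@bump_measure_eq _ M); [exact: bumpM|exact: restrict].
- move=> S mS e; rewrite setIC -setDE !measureD//; last 2 first.
  + by rewrite ltey_eq fin_num_measure.
  + by rewrite ltey_eq fin_num_measure.
  by congr (_ - _)%E; [exact: U_eq|rewrite setIC; exact: e].
- move=> F mF tF e; rewrite setI_bigcupl !measure_bigcup//.
  + by apply: eq_eseriesr => i _; exact: e.
  + by move=> i _; exact: measurableI.
  + exact: trivIset_setIr.
  + by move=> i _; exact: measurableI.
  + exact: trivIset_setIr.
Qed.

Definition charged_points := [set x | forall r, 0 < r <= 1 -> ~ null_arc x r].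

Lemma charged_points_periodic (k : int) x :
  charged_points x -> charged_points (x + (pi *+ 2) *~ k).
Proof.
move=> Kx r /Kx; rewrite /null_arc (_ : arc (x + _) r = arc x r)//.
congr (theta @^-1` _); apply/funext => y /=.
by rewrite chordC (periodicz (periodic_chord y)) chordC.
Qed.

(** Each uncharged point lies in a null arc with rational centre and radius of the form
    [1 / (n + 1)], and there are countably many of these. *)
Lemma negligible_uncharged (m : {finite_measure set T -> \bar R}) :
  (forall x r, null_arc x r -> m (arc x r) = 0%E) ->
  m.-negligible (theta @^-1` ~` charged_points).
Proof.
move=> m0.
pose s n : R := n.+1%:R^-1.
have s01 n : 0 < s n <= 1.
  by rewrite invr_gt0 ltr0n/= invf_le1 ?ler1n// ltr0n.
pose F (p : rat * nat) := if `[< null_arc (ratr p.1) (s p.2) >]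
  then arc (ratr p.1) (s p.2) else set0.
apply: (@negligibleS _ _ _ _ (\bigcup_p F p)); last first.
  apply: negligible_bigcup_countable => -[q n]; rewrite /F/=.
  case: asboolP => [nq|_]; last exact: negligible_set0.
  by exists (arc (ratr q) (s n)); split; [exact: measurable_arc|exact: m0|].
move=> t /= /existsNP[r /not_implyP[r01 /contrapT[Pr Nr]]].
have [r0 r1] := andP r01.
(* Twice the radius fits in [r], so the arc about a rational point within [s n] of [theta t] stays
   inside the null arc of radius [r]. *)
have [n nr] : exists n, s n + s n <= r.
  have r20 : 0 < r / 2 by lra.
  have := near_infty_natSinv_lt (PosNum r20) => -[n _ /(_ n (leqnn _))/= h].
  by exists n; rewrite [leRHS]splitr lerD// ltW.
have [sn0 sn1] := andP (s01 n).
have [q qt] : exists q, chord (theta t) (ratr q) < s n.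
  have : \forall y \near theta t, chord (theta t) y < s n.
    apply: (cvgr_lt _ (@continuous_chord R (theta t) (theta t))).
    by rewrite /chord subrr mul0r sin0 normr0.
  move=> /nbhs_ballP[e /= e0 eP].
  have [q] : exists q, ratr q \in `]theta t, theta t + e[.
    by apply: rat_in_itvoo; rewrite ltrDl.
  rewrite in_itv/= => /andP[q1 q2]; exists q; apply: eP.
  by rewrite /ball/= ltr_distl; lra.
have sub : arc (ratr q) (s n) `<=` arc (theta t) r.
  rewrite /arc => u /= qu; rewrite (le_lt_trans (chord_triangle (ratr q) _ _))//.
  by rewrite (lt_le_trans _ nr)// ltrD.
exists (q, n) => //; rewrite /F/=.
case: asboolP => [_|]; first by rewrite /arc/= chordC.
case; have ma := measurable_arc (theta t) r01; have mq := measurable_arc (ratr q) (s01 n).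
by split; apply: (subset_measure0 _ _ sub).
Qed.

Lemma total_mass0 : P setT = 0%E /\ N setT = 0%E.
Proof.
have nP : P.-negligible (theta @^-1` ~` charged_points).
  by apply: negligible_uncharged => x r [].
have nN : N.-negligible (theta @^-1` ~` charged_points).
  by apply: negligible_uncharged => x r [].
have g1 : bmf (fun=> 1) by exact: bmf_cst.
suff K0 : charged_points = set0.
  move: nP nN; rewrite K0 setC0 preimage_setT.
  by move=> /(negligibleP _ measurableT) ? /(negligibleP _ measurableT) ?.
apply: contrapT => /eqP/set0P K0.
(* The Baire argument gives a bound near one charged point; the arc about that point will turn out
   to be null. *)
have [||x [r [M [Kx r0 KM]]]] := exists_locally_bounded_on
    (F := fun k => fsum (fun=> 1) (nn k)) _ _ K0.
- by move=> k; exact: continuous_fsum.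
- move=> x; have := cvg_seq_bounded (cvgP _ (@fsum_cvg0 x)).
  move=> /pinfty_ex_gt0[M M0 h]; exists M => k; exact: h.
(* The bound holds for real points close to [x], whereas an arc only means close modulo 2 pi;
   periodicity of the charged points and of [fsum] bridges this. *)
have [s s01 lift] := chord_lift r0.
apply: (Kx _ s01); apply: (@null_arc_of_bounded _ _ M) => //.
have bnd t : charged_points (theta t) ->
    forall k, arc_bump x s (theta t) != 0 -> `|fsum (fun=> 1) (nn k) (theta t)| <= M.
  move=> Kt k; have [s0 s1] := andP s01.
  have [_ _ /(_ (theta t))/andP[a0 _]] : bump (arc_bump x s).
    by apply: bump_arc_bump; rewrite ltW.
  move=> fx; have /lift[j tj] : chord x (theta t) < s.
    by rewrite -(arc_bump_gt0 _ _ (ltW s0)) lt_def fx.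
  rewrite -(periodicz (@periodic_fsum (fun=> 1) (nn k)) j).
  by apply: KM => //; exact: charged_points_periodic.
by split; [move: nP|move: nN]; apply: negligibleS => t /= h;
  apply: contra_not h; exact: bnd.
Qed.

End signed_measure.
(** * Charges on the circle *)

Section circle_topology.
Local Open Scope quotient_scope.
Variable R : realType.

Definition angle (t : circleB R) : R := repr (t : circle R).

Lemma pi_circle_eq (a b : R) :
  (\pi_(circle R) a == \pi_(circle R) b) = eqmod2pi a b.
Proof.
by apply/eqP/idP => [ab|ab]; apply/(eqmodP (eqmod2pi_equiv R) a b).
Qed.

(** A periodic function is constant on classes, so it factors through the quotient although [repr]
    itself is arbitrary. *)
Lemma continuous_angle (f : R -> R) : continuous f -> periodic f (pi *+ 2) ->
  continuous (fun t : circle R => f (repr t)).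
Proof.
move=> cf pf.
apply: (@repr_comp_continuous R {eq_quot (@eqmod2pi_equiv R)} R f cf) => a b.
move=> ab; have /asboolP[k {}ab] : eqmod2pi a b by rewrite -pi_circle_eq.
apply/eqP.
rewrite -(subrK b a) ab addrC -(periodicz pf k b).
by rewrite [2 * pi]mulr_natl mulrzr.
Qed.

Lemma measurable_angle (f : R -> R) : continuous f -> periodic f (pi *+ 2) ->
  measurable_fun setT (fun t => f (angle t)).
Proof.
move=> cf pf; apply: (@measurability _ _ (circleB R) _ setT (fun t => f (angle t)) _
  (RGenOpens.measurableE R)).
move=> _ [_ [a [b ->]] <-]; rewrite setTI; apply: sub_sigma_algebra.
have /continuousP := continuous_angle cf pf; apply.
exact: interval_open.
Qed.

Lemma open_arc (x r : R) : open (arc angle x r : set (circle R)).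
Proof.
have /continuousP := continuous_angle (@continuous_chord R x) (periodic_chord x).
move=> /(_ [set y | y < r]); apply; exact: open_lt.
Qed.

(** These countably many arcs form a base: [chord_lift] turns chordal closeness into ordinary
    closeness modulo 2 pi, where openness is tested. *)
Lemma open_circle_arc (O : set (circle R)) t : open O -> O t ->
  exists (q : rat) n, arc angle (ratr q) (n.+1%:R^-1) t /\
    arc angle (ratr q) (n.+1%:R^-1) `<=` O.
Proof.
move=> oO Ot; pose x := angle t.
have Ox : (\pi_(circle R) @^-1` O) x by rewrite /= reprK.
have [e /= e0 eO] : exists2 e : R, 0 < e & ball x e `<=` \pi_(circle R) @^-1` O.
  have oO' : open (\pi_(circle R) @^-1` O : set R) by exact: oO.
  have /nbhs_ballP[e e0 h] := open_nbhs_nbhs (conj oO' Ox).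
  by exists e.
have [s /andP[s0 s1] lift] := chord_lift e0.
have arcO u : chord x (angle u) < s -> O u.
  move=> /lift[k uk]; have := eO (angle u + (pi *+ 2) *~ k).
  rewrite /ball/= distrC => /(_ uk).
  suff -> : \pi_(circle R) (angle u + (pi *+ 2) *~ k) = u by [].
  rewrite -[RHS]reprK; apply/eqP; rewrite pi_circle_eq; apply/asboolP; exists k.
  by rewrite addrC addKr [2 * pi]mulr_natl mulrzr.
have [n ns] : exists n, (n.+1%:R^-1 : R) < s / 2.
  have s20 : 0 < s / 2 by lra.
  have := near_infty_natSinv_lt (PosNum s20) => -[n _ /(_ n (leqnn _))/= h].
  by exists n.
have : \forall y \near x, chord x y < n.+1%:R^-1.
  apply: (cvgr_lt _ (@continuous_chord R x x)).
  by rewrite /chord subrr mul0r sin0 normr0 invr_gt0 ltr0n.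
move=> /nbhs_ballP[d /= d0 dP].
have [q] : exists q, ratr q \in `]x, x + d[ by apply: rat_in_itvoo; rewrite ltrDl.
rewrite in_itv/= => /andP[q1 q2].
have xq : chord x (ratr q) < n.+1%:R^-1.
  by apply: dP; rewrite /ball/= ltr_distl; lra.
exists q, n; split; first by rewrite /arc/= chordC.
rewrite /arc => u /= qu; apply: arcO.
rewrite (le_lt_trans (chord_triangle (ratr q) _ _))//.
by rewrite [ltRHS]splitr ltrD// (lt_trans _ ns).
Qed.

Lemma measurable_circle_arcs : @measurable _ (circleB R) =
  <<s [set A | exists x r : R, 0 < r <= 1 /\ A = arc (angle : circleB R -> R) x r] >>.
Proof.
apply/seteqP; split; last first.
  apply: smallest_sub; first exact: sigma_algebra_measurable.
  by move=> _ [x [r [_ ->]]]; apply: sub_sigma_algebra; exact: open_arc.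
apply: smallest_sub; first exact: smallest_sigma_algebra.
move=> O oO; pose s n : R := n.+1%:R^-1.
pose F (p : rat * nat) := if `[< arc angle (ratr p.1) (s p.2) `<=` O >]
  then arc angle (ratr p.1) (s p.2) else set0.
have -> : O = \bigcup_p F p.
  apply/seteqP; split=> t.
    move=> /(open_circle_arc oO)[q [n [qt qO]]]; exists (q, n) => //.
    by rewrite /F/=; case: asboolP.
  by move=> [[q n] _]; rewrite /F/=; case: asboolP => [qO /qO|].
apply: (@countable_bigcupT_measurable _ (g_sigma_algebraType
    [set A | exists x r : R, 0 < r <= 1 /\
                             A = arc (angle : circleB R -> R) x r])) => // -[q n].
rewrite /F/=; case: asboolP => _; last exact: measurable0.
apply: sub_sigma_algebra; exists (ratr q), (s n); split=> //.
by rewrite invr_gt0 ltr0n/= invf_le1 ?ler1n// ltr0n.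
Qed.

End circle_topology.

(** * From charges to pairs of finite measures *)

(** It suffices to test [E = A], which the negative part does not charge, and [E = B], which the
    positive part does not charge. *)
Lemma jordan_mutually_singular d (T : measurableType d) (R : realType)
    (nu : {charge set T -> \bar R}) (A B : set T)
    (nuAB : hahn_decomposition nu A B) (U : set T) : measurable U ->
  (forall E, measurable E ->
    jordan_pos nuAB (E `&` U) = jordan_neg nuAB (E `&` U)) ->
  jordan_pos nuAB U = 0%E /\ jordan_neg nuAB U = 0%E.
Proof.
move=> mU e; have [[mA _] [mB _] _ AB0] := nuAB.
have posE E : measurable E -> jordan_pos nuAB E = nu (E `&` A).
  by move=> mE; rewrite jordan_posE cjordan_posE /crestr0 mem_set.
have negE E : measurable E -> jordan_neg nuAB E = (- nu (E `&` B))%E.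
  by move=> mE; rewrite jordan_negE cjordan_negE /crestr0 mem_set.
have := e _ mB; have := e _ mA.
rewrite !posE ?negE; try (exact: measurableI || exact: mU).
have -> : A `&` U `&` A = U `&` A by rewrite setIAC setIid setIC.
have -> : A `&` U `&` B = set0 by rewrite setIAC AB0 set0I.
have -> : B `&` U `&` A = set0 by rewrite setIAC [B `&` A]setIC AB0 set0I.
have -> : B `&` U `&` B = U `&` B by rewrite setIAC setIid setIC.
by rewrite charge0 oppe0 => -> <-.
Qed.

Lemma charge_integral_jordan d (T : measurableType d) (R : realType)
    (nu : {charge set T -> \bar R}) (theta : T -> R) :
  exists P N : {finite_measure set T -> \bar R},
    [/\ forall U, measurable U ->
          (forall A, measurable A -> P (A `&` U) = N (A `&` U)) ->
          P U = 0%E /\ N U = 0%E,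
        forall A, measurable A -> nu A = (P A - N A)%E &
        forall f, charge_integral nu (fun t => f (theta t)) = signed_int P N theta f].
Proof.
pose hahn := projT2 (cid (hahn_decompositionP nu)).
exists (jordan_pos hahn), (jordan_neg hahn); split=> //.
  exact: jordan_mutually_singular.
by move=> A mA; rewrite (jordan_decomp hahn mA) /cadd/= cscaleN1.
Qed.

(** * The theorem for real measures *)

Section real_charge.
Variables (R : realType) (nu : {charge set (circleB R) -> \bar R}).
Implicit Types (l : int) (n : nat) (x : R).

Definition cos_coef l : R := charge_integral nu (fun t => cos (l%:~R * angle t)).

Definition sin_coef l : R := charge_integral nu (fun t => sin (l%:~R * angle t)).

(* This is [2 * pi] times the n-th partial Fourier sum of [nu] at [x]. *)
Definition real_fourier_sum n x : R := cos_coef 0 +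
  \sum_(l < n) 2 * (cos_coef l.+1 * cos (l.+1%:R * x) +
                    sin_coef l.+1 * sin (l.+1%:R * x)).

Lemma charge_eq0_of_fourier_sum_cvg0 (n : nat -> nat) :
  cos_coef k%:Z @[k --> \oo] --> (0 : R) ->
  sin_coef k%:Z @[k --> \oo] --> (0 : R) ->
  n k @[k --> \oo] --> \oo ->
  (forall x, x \in `[0, 2 * pi] ->
    real_fourier_sum (n k) x @[k --> \oo] --> (0 : R)) ->
  forall A, measurable A -> nu A = 0%E.
Proof.
move=> c0 s0 noo F0 A mA.
have [P [N [PN_sing PNE intE]]] := charge_integral_jordan nu (@angle R).
have mt := @measurable_angle R.
have FE k x : fsum P N (@angle R) (fun=> 1) (n k) x = real_fourier_sum (n k) x.
  rewrite (fsum1E P N mt) /real_fourier_sum; congr (_ + _).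
    rewrite -intE; congr charge_integral; apply/funext => t.
    by rewrite mul0r cos0.
  by apply: eq_bigr => l _; rewrite -!intE.
have [||||p0 n0] := @total_mass0 _ _ _ P N (@angle R) mt _ n noo.
- apply: (rajchman_cst1 mt).
    by apply: eq_cvgn c0 => k; rewrite -intE.
  by apply: eq_cvgn s0 => k; rewrite -intE.
- move=> x.
  (* Convergence is assumed on one period only and is carried to all real [x] by translation. *)
  have [k xk] : exists k : int, x + (pi *+ 2) *~ k \in `[0, 2 * pi].
    have p0 : 0 < pi *+ 2 :> R by rewrite mulr2n addr_gt0// pi_gt0.
    exists (- Num.floor (x / (pi *+ 2))).
    have := floor_itv (x / (pi *+ 2)); rewrite mulrNz.
    move: (Num.floor _) => m; rewrite in_itv/=.
    rewrite ler_pdivlMr// ltr_pdivrMr// -[pi *+ 2 *~ m]mulrzl intrD mulrDl mulr2n.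
    by lra.
  apply: eq_cvgn (F0 _ xk) => j.
  by rewrite -FE (periodicz (@periodic_fsum _ _ _ P N (@angle R) (fun=> 1) (n j))).
- exact: measurable_circle_arcs.
- exact: PN_sing.
have sub (m : {finite_measure set (circleB R) -> \bar R}) : m setT = 0%E -> m A = 0%E.
  by move=> m0; apply: (subset_measure0 mA measurableT (@subsetT _ A)).
by rewrite (PNE _ mA) (sub P p0) (sub N n0) sube0.
Qed.

End real_charge.

(** * Reduction of complex measures to their real and imaginary parts *)

Section complex_reduction.
Variable R : realType.

Lemma normc_lt_parts (z : R[i]) (e : R) : `|z| < (e%:C)%C ->
  `|complex.Re z| < e /\ `|complex.Im z| < e.
Proof.
move=> ze; split; rewrite -ltcR; apply: le_lt_trans ze; first exact: normc_ge_Re.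
case: z => a b; rewrite normc_def/= lecR -sqrtr_sqr.
by rewrite ler_wsqrtr// lerDr sqr_ge0.
Qed.

Lemma cvg0_complex_parts (u : nat -> R[i]) :
  (u k : R[i]^o) @[k --> \oo] --> (0 : R[i]^o) ->
  complex.Re (u k) @[k --> \oo] --> (0 : R) /\
  complex.Im (u k) @[k --> \oo] --> (0 : R).
Proof.
move=> /cvgr0Pnorm_lt u0; split; apply/cvgr0Pnorm_lt => e e0;
  have /u0 : 0 < (e%:C)%C by [rewrite ltcR];
  by apply: filterS => k /normc_lt_parts[].
Qed.

Lemma sum_complex_parts n (a b : nat -> R) :
  \sum_(i < n) (a i +i* b i)%C = ((\sum_(i < n) a i) +i* (\sum_(i < n) b i))%C.
Proof.
by elim: n => [|n IH]; rewrite ?big_ord0// !big_ord_recr/= IH.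
Qed.

Lemma sum_symmetric_range (V : zmodType) (G : int -> V) n :
  \sum_(0 <= j < (2 * n).+1) G (j%:Z - n%:Z) =
  G 0 + \sum_(l < n) (G l.+1%:Z + G (- l.+1%:Z)).
Proof.
elim: n => [|n IH]; first by rewrite muln0 big_nat1 big_ord0 !addr0.
rewrite (_ : (2 * n.+1).+1 = (2 * n).+1.+2); last by rewrite mulnS.
rewrite big_nat_recr//= big_nat_recl//= big_ord_recr/= addrA -IH.
have -> : (2 * n).+2%:Z - n.+1%:Z = n.+1%:Z by rewrite mul2n -addnn; lia.
have -> : 0%:Z - n.+1%:Z = - n.+1%:Z by lia.
rewrite -addrA addrCA [G (- _) + _]addrC; congr (_ + _).
by apply: eq_bigr => j _; congr G; lia.
Qed.

Variable mu : {charge set (circleB R) -> \bar R[i]}.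

Let kappa : R := (2 * pi)^-1.
Let cr := cos_coef (re_charge mu).
Let sr := sin_coef (re_charge mu).
Let ci := cos_coef (im_charge mu).
Let si := sin_coef (im_charge mu).

Lemma cos_coefN (nu : {charge set (circleB R) -> \bar R}) l :
  cos_coef nu (- l) = cos_coef nu l.
Proof.
by congr charge_integral; apply/funext => t; rewrite mulrNz mulNr cosN.
Qed.

(** Unlike the cosine case this needs linearity of the integral, obtained by passing to
    [signed_int]. *)
Lemma sin_coefN (nu : {charge set (circleB R) -> \bar R}) l :
  sin_coef nu (- l) = - sin_coef nu l.
Proof.
have [P [N [_ _ intE]]] := charge_integral_jordan nu (@angle R).
have mt := @measurable_angle R.
have gs : bmf (@angle R) (fun y => sin (l%:~R * y)).
  case: l => n; first exact: (bmf_sinn mt).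
  under eq_fun do rewrite NegzE mulrNz mulNr sinN -mulN1r.
  by apply: bmfM; [exact: bmf_cst|exact: (bmf_sinn mt)].
rewrite /sin_coef !(intE (fun y => sin (_ * y))).
rewrite -[RHS]mulN1r -signed_intZ//.
by congr signed_int; apply/funext => y; rewrite mulrNz mulNr sinN mulN1r.
Qed.

Lemma fourier_coefE l : fourier_coef mu l =
  ((kappa * (cr l + si l)) +i* (kappa * (ci l - sr l)))%C.
Proof.
have cE nu : charge_integral nu
    (fun t : circleB R => cos (- (l%:~R * angle t))) = cos_coef nu l.
  by congr charge_integral; apply/funext => t; rewrite cosN.
have sE nu : charge_integral nu
    (fun t : circleB R => sin (- (l%:~R * angle t))) = - sin_coef nu l.
  rewrite -sin_coefN; congr charge_integral; apply/funext => t.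
  by rewrite mulrNz mulNr.
rewrite /fourier_coef /complex_charge_integral /= !cE !sE.
apply/eqP; rewrite eq_complex/= -/cr -/ci -/sr -/si -/kappa.
by apply/andP; split; apply/eqP; ring.
Qed.

(** Pairing [l] with [- l] cancels the cross terms between the two parts of [mu], because the
    Dirichlet kernel is real. *)
Lemma fourier_sumE n x : fourier_sum mu n x =
  ((kappa * real_fourier_sum (re_charge mu) n x) +i*
   (kappa * real_fourier_sum (im_charge mu) n x))%C.
Proof.
have s0 nu : sin_coef nu 0 = 0 :> R.
  by have := sin_coefN nu 0; rewrite oppr0; lra.
rewrite /fourier_sum (sum_symmetric_range (fun l => fourier_coef mu l * cis (l%:~R * x))).
rewrite (eq_bigr (fun l : 'I_n =>
  ((kappa * (2 * (cr l.+1 * cos (l.+1%:R * x) + sr l.+1 * sin (l.+1%:R * x)))) +i*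
   (kappa * (2 * (ci l.+1 * cos (l.+1%:R * x) + si l.+1 * sin (l.+1%:R * x)))))%C)).
  rewrite (sum_complex_parts n
    (fun l => kappa * (2 * (cr l.+1 * cos (l.+1%:R * x) + sr l.+1 * sin (l.+1%:R * x))))
    (fun l => kappa * (2 * (ci l.+1 * cos (l.+1%:R * x) + si l.+1 * sin (l.+1%:R * x))))).
  rewrite /real_fourier_sum -!mulr_sumr fourier_coefE -/cr -/ci -/sr -/si.
  rewrite /cis mul0r cos0 sin0 /cr /ci /si /sr !s0.
  by apply/eqP; rewrite eq_complex/=; apply/andP; split; apply/eqP; ring.
move=> l _; rewrite !fourier_coefE /cr /ci /si /sr !cos_coefN !sin_coefN /cis.
rewrite mulrNz mulNr cosN sinN.
by apply/eqP; rewrite eq_complex/=; apply/andP; split; apply/eqP; ring.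
Qed.

End complex_reduction.

Theorem proposition4 (R : realType)
    (mu : {charge set (circleB R) -> \bar R[i]})
    (mu_hat0 : forall e : R, 0 < e -> exists N : nat, forall l : int,
       (N <= `|l|)%N -> `|fourier_coef mu l| < (e%:C)%C)
    (n : nat -> nat)
    (n_gt0 : forall k, (0 < n k)%N)
    (n_oo : n k @[k --> \oo] --> \oo)
    (fourier_sum0 : forall x : R, x \in `[0, 2 * pi] ->
       (fourier_sum mu (n k) x : R[i]^o) @[k --> \oo] --> (0 : R[i]^o)) :
  forall A : set (circleB R), measurable A -> mu A = 0%E.
Proof.
have pi0 : (pi : R) != 0 by rewrite gt_eqF// pi_gt0.
(* The boolean selects the sign of the frequency, so positive and negative frequencies are treated
   at once. *)
have part0 (p : R[i] -> R) (s : bool) :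
    (forall z e, `|z| < (e%:C)%C -> `|p z| < e) ->
    p (fourier_coef mu ((-1) ^+ s * k%:Z)) @[k --> \oo] --> (0 : R).
  move=> pe; apply/cvgr0Pnorm_lt => e /mu_hat0[N hN]; exists N => // k /= Nk.
  by apply: pe; apply: hN; rewrite abszMsign.
have re_part z (e : R) : `|z| < (e%:C)%C -> `|complex.Re z| < e.
  by case/normc_lt_parts.
have im_part z (e : R) : `|z| < (e%:C)%C -> `|complex.Im z| < e.
  by case/normc_lt_parts.
have rp := part0 _ false re_part; have rn := part0 _ true re_part.
have ip := part0 _ false im_part; have im := part0 _ true im_part.
(* Sums and differences of the coefficients at [k] and [- k] recover the cosine and sine integrals
   of each part; the factor [pi] undoes [1 / (2 * pi)] together with the doubling. *)
have half (u v w : nat -> R) : (forall k, w k = pi * (u k + v k)) ->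
    u k @[k --> \oo] --> (0 : R) -> v k @[k --> \oo] --> (0 : R) ->
    w k @[k --> \oo] --> (0 : R).
  move=> wE u0 v0; apply: (eq_cvgn wE); rewrite -[0](mulr0 pi).
  by apply: cvgMl_tmp; rewrite -[0]addr0; exact: cvgD.
have half' (u v w : nat -> R) : (forall k, w k = pi * (u k - v k)) ->
    u k @[k --> \oo] --> (0 : R) -> v k @[k --> \oo] --> (0 : R) ->
    w k @[k --> \oo] --> (0 : R).
  move=> wE u0 v0; apply: (half u (fun k => - v k)) => //.
  by rewrite -oppr0; exact: cvgN.
have sum0 (p : R[i] -> R) (nu : {charge set (circleB R) -> \bar R}) :
    (forall m x, p (fourier_sum mu m x) = (2 * pi)^-1 * real_fourier_sum nu m x) ->
    (forall u : nat -> R[i], (u k : R[i]^o) @[k --> \oo] --> (0 : R[i]^o) ->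
      p (u k) @[k --> \oo] --> (0 : R)) ->
    forall x, x \in `[0, 2 * pi] ->
    real_fourier_sum nu (n k) x @[k --> \oo] --> (0 : R).
  move=> pE p0 x /fourier_sum0/p0 h.
  apply: (@eq_cvgn _ (fun k => 2 * pi * p (fourier_sum mu (n k) x))) => [k|].
    by rewrite pE mulVKf// mulf_neq0// pnatr_eq0.
  by rewrite -[0](mulr0 (2 * pi)); exact: cvgMl_tmp.
have re0 : forall A, measurable A -> re_charge mu A = 0%E.
  apply: (charge_eq0_of_fourier_sum_cvg0 (n := n)) => //.
  - apply: half rp rn => k; rewrite !fourier_coefE/= mul1r mulN1r.
    by rewrite cos_coefN sin_coefN; move: (pi : R) pi0 => p p0; field.
  - apply: half' im ip => k; rewrite !fourier_coefE/= mul1r mulN1r.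
    by rewrite cos_coefN sin_coefN; move: (pi : R) pi0 => p p0; field.
  - apply: (sum0 (@complex.Re R)) => [m x|u /cvg0_complex_parts[]//].
    by rewrite fourier_sumE.
have im0 : forall A, measurable A -> im_charge mu A = 0%E.
  apply: (charge_eq0_of_fourier_sum_cvg0 (n := n)) => //.
  - apply: half ip im => k; rewrite !fourier_coefE/= mul1r mulN1r.
    by rewrite cos_coefN sin_coefN; move: (pi : R) pi0 => p p0; field.
  - apply: half' rp rn => k; rewrite !fourier_coefE/= mul1r mulN1r.
    by rewrite cos_coefN sin_coefN; move: (pi : R) pi0 => p p0; field.
  - apply: (sum0 (@complex.Im R)) => [m x|u /cvg0_complex_parts[]//].
    by rewrite fourier_sumE.
move=> A mA; have : mu A \is a fin_num by exact: fin_num_measure.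
move=> /fineK <-; congr EFin.
have := re0 A mA; have := im0 A mA; rewrite /re_charge /im_charge.
by case: (fine (mu A)) => a b /= [->] [->].
Qed.
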